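(* There exist absolute constants $c,C>0$ such that for every integer $n\ge 3$ there is a graph $\mathcal{G}=(\mathcal{V},\mathcal{E}_1,\emptyset)$ on $\mathcal{V}=[n]$, with $\mathcal{G}_1=(\mathcal{V},\mathcal{E}_1)$ connected and non-bipartite and $\Omega:=\Omega(\mathcal{G})$, for which the following holds. Let $g:\mathbb{R}^{n\times n}\to\mathbb{R}$ be a twice continuously differentiable loss function whose unique minimizer among matrices supported on $\Omega$ is the zero matrix, and suppose that $g$ satisfies the sparse $(\delta,1)$-RIP condition in the $\Omega$-norm for some $\delta\in[0,1)$ with $\delta\le c/n$. Consider an absolutely continuous radial probability distribution on $\mathbb{R}^n$. Then there exists an instance $\mathcal{P}_{\mathbf{M}^*,\Omega,n,1}$ in $\mathcal{L}(\mathcal{G},n,1)$ such that, for the problem $\min_{\mathbf{x}\in\mathbb{R}^n} f(\mathbf{x})$ with $f(\mathbf{x}):=g[(\mathbf{x}\mathbf{x}^T-\mathbf{M}^* )_\Omega]$: \begin{itemize} \item the global minima are unique up to a sign flip; \item if the gradient flow $\dot{\mathbf{x}}(t)=-\nabla f(\mathbf{x}(t))$, $\mathbf{x}(0)=\mathbf{x}_0$, is initialized with $\mathbf{x}_0$ drawn from the given distribution, then it converges to a global minimum associated with the ground truth solution with probability at most $C\,2^{-\lceil n/2\rceil}$. \end{itemize}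
   Context: For $\Omega\subset[n]\times[n]$, $\mathbf{M}_\Omega$ denotes the matrix whose $(i,j)$ entry is $\mathbf{M}_{ij}$ if $(i,j)\in\Omega$ and $0$ otherwise. The problem $\mathcal{P}_{\mathbf{M}^*,\Omega,n,1}$ is: find $\mathbf{M}\in\mathbb{R}^{n\times n}$ with $\mathrm{rank}(\mathbf{M})\le 1$, $\mathbf{M}\succeq 0$, $\mathbf{M}_\Omega=\mathbf{M}^*_\Omega$. Graphs are undirected on node set $[n]$, may have self-loops, and edge sets are regarded as symmetric subsets of $[n]\times[n]$; a self-loop counts as an odd cycle. For $\mathcal{G}=(\mathcal{V},\mathcal{E}_1,\emptyset)$ and $r=1$, the induced measurement set is $\Omega(\mathcal{G})=\mathcal{E}_1$. The class $\mathcal{L}(\mathcal{G},n,1)$ consists of the problems $\mathcal{P}_{\mathbf{M}^*,\Omega,n,1}$ such that $\mathbf{M}^*$ is a PSD $n\times n$ matrix of rank $1$, all entries of $\mathbf{M}^*$ are nonzero, and $\Omega=\Omega(\mathcal{G})$ with $\mathcal{G}_1$ connected and non-bipartite. Sparse $(\delta,r)$-RIP condition in the $\Omega$-norm: $$(1-\delta)\|\mathbf{N}_\Omega\|_F^2\le \mathbf{N}:\nabla^2 g(\mathbf{M}_\Omega):\mathbf{N}\le(1+\delta)\|\mathbf{N}_\Omega\|_F^2$$ for all $\mathbf{M},\mathbf{N}\in\mathbb{R}^{n\times n}$ of rank at most $2r$, where $\mathbf{N}:\nabla^2 g(\cdot):\mathbf{N}$ is the quadratic form of the Hessian of $g$ in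 direction $\mathbf{N}$. A probability distribution on $\mathbb{R}^n$ is radial if its density at $\mathbf{x}$ depends only on $\|\mathbf{x}\|$; absolute continuity is with respect to Lebesgue measure. A global minimum associated with the ground truth is a global minimizer $\mathbf{x}$ with $\mathbf{x}\mathbf{x}^T=\mathbf{M}^*$. *)

(* Defs.v *)
From HB Require Import structures.
From mathcomp Require Import all_boot all_order all_algebra.
From mathcomp Require Import all_classical all_reals all_analysis.

Set Implicit Arguments.
Unset Strict Implicit.
Unset Printing Implicit Defensive.

Import Order.TTheory GRing.Theory Num.Theory.
Import numFieldNormedType.Exports.

Local Open Scope classical_set_scope.
Local Open Scope ring_scope.

Section LebesgueTuple.
Context {R : realType}.

Definition cons_pair n (p : measurableTypeR R * n.-tuple R) : n.+1.-tuple R :=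
  [tuple of p.1 :: p.2].

Lemma measurable_cons_pair n : measurable_fun setT (@cons_pair n).
Proof. exact: (measurable_cons (T2 := R) measurable_fst measurable_snd). Qed.

Definition uncons_pair n (t : n.+1.-tuple R) : measurableTypeR R * n.-tuple R :=
  (thead t, [tuple of behead t]).

Lemma measurable_uncons_pair n : measurable_fun setT (@uncons_pair n).
Proof.
apply/measurable_fun_pairP; split; last exact: measurable_behead.
exact: (@measurable_tnth _ R n.+1 ord0).
Qed.

Lemma cons_pairK n : cancel (@cons_pair n) (@uncons_pair n).
Proof.
by case=> x t; rewrite /uncons_pair /cons_pair /= theadE; congr pair; exact: val_inj.
Qed.

Section step.
Variables (n : nat) (mu : {sigma_finite_measure set (n.-tuple R) -> \bar R}).

Let nu : {measure set (measurableTypeR R * n.-tuple R)%type -> \bar R} :=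
  (@lebesgue_measure R \x mu)%E.

Definition lebesgue_tupleS : set (n.+1.-tuple R) -> \bar R :=
  pushforward (@lebesgue_measure R \x mu)%E (@cons_pair n).

Lemma lebesgue_tupleS0 : lebesgue_tupleS set0 = 0%E.
Proof. by rewrite /lebesgue_tupleS /pushforward preimage_set0 (measure0 nu). Qed.

Lemma lebesgue_tupleS_ge0 A : (0 <= lebesgue_tupleS A)%E.
Proof. exact: (measure_ge0 nu). Qed.

Lemma lebesgue_tupleS_sigma_additive : semi_sigma_additive lebesgue_tupleS.
Proof.
have mc := @measurable_cons_pair n.
move=> F mF tF mUF; rewrite /lebesgue_tupleS /pushforward preimage_bigcup.
apply: (measure_semi_sigma_additive (s := nu)).
- by move=> k; rewrite -[X in measurable X]setTI; exact: mc.
- apply/trivIsetP => /= i j _ _ ij; rewrite -preimage_setI.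
  by move/trivIsetP : tF => /(_ _ _ _ _ ij) ->//; rewrite preimage_set0.
- by rewrite -preimage_bigcup -[X in measurable X]setTI; exact: mc.
Qed.

HB.instance Definition _ := isMeasure.Build _ _ _ lebesgue_tupleS
  lebesgue_tupleS0 lebesgue_tupleS_ge0 lebesgue_tupleS_sigma_additive.

Lemma lebesgue_tupleS_sigma_finite : sigma_finite setT lebesgue_tupleS.
Proof.
have /sigma_finiteP[F [TF ndF Foo]] := sigma_finiteT (@lebesgue_measure R).
have /sigma_finiteP[G [TG ndG Goo]] := sigma_finiteT mu.
exists (fun k => @uncons_pair n @^-1` (F k `*` G k)).
  rewrite -preimage_bigcup; apply/esym/seteqP; split => // t _.
  have : setT (uncons_pair t).1 by [].
  have : setT (uncons_pair t).2 by [].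
  rewrite TF TG => -[k _ Gk] [l _ Fl]; exists (maxn k l) => //; split.
    by move: Fl; exact/subsetPset/ndF/leq_maxr.
  by move: Gk; exact/subsetPset/ndG/leq_maxl.
move=> k; have [mF Fk] := Foo k; have [mG Gk] := Goo k; split.
  rewrite -[X in measurable X]setTI; apply: measurable_uncons_pair => //.
  exact: measurableX.
rewrite /lebesgue_tupleS /pushforward (_ : _ @^-1` _ = F k `*` G k); last first.
  by apply/funext => p; rewrite /preimage /mkset cons_pairK.
by rewrite product_measure1E// lte_mul_pinfty// ge0_fin_numE.
Qed.

HB.instance Definition _ := Measure_isSigmaFinite.Build _ _ _
  lebesgue_tupleS lebesgue_tupleS_sigma_finite.

End step.

(* Lebesgue measure on R^n, as the n-fold product of Lebesgue measure on R;
   on the one-point space 0.-tuple R it is the unit mass. *)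
Fixpoint lebesgue_tuple n : {sigma_finite_measure set (n.-tuple R) -> \bar R} :=
  match n with
  | 0 => \d_([tuple] : 0.-tuple R)
  | n'.+1 => lebesgue_tupleS (lebesgue_tuple n')
  end.

End LebesgueTuple.

Section Graphs.
Variable n : nat.

(* An undirected graph on 'I_n is its edge set, a symmetric set of pairs;
   a self-loop at i is the pair (i, i). *)
Definition symmetric_edges (E : {set 'I_n * 'I_n}) : Prop :=
  forall i j, (i, j) \in E -> (j, i) \in E.

Definition connected_graph (E : {set 'I_n * 'I_n}) : Prop :=
  forall i j, connect [rel u v | (u, v) \in E] i j.

(* A graph with a self-loop is never bipartite. *)
Definition bipartite (E : {set 'I_n * 'I_n}) : Prop :=
  exists side : 'I_n -> bool, forall i j, (i, j) \in E -> side i != side j.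

End Graphs.

Section Optimization.
Context {R : realType}.

Definition is_argmin (V : Type) (D : set V) (F : V -> R) (x : V) : Prop :=
  D x /\ forall y, D y -> F x <= F y.

(* For a finite-dimensional V this is the usual class C^2: the first and second
   Frechet derivatives are determined by their values on vectors. *)
Definition class_C2 (V : normedModType R) (g : V -> R) : Prop :=
  [/\ forall x, differentiable g x,
      forall u x, differentiable ('D_u g) x
    & forall u v, continuous ('D_v ('D_u g))].

Definition hessian_quad (V : normedModType R) (g : V -> R) (x u : V) : R :=
  'D_u ('D_u g) x.

Definition gradient n (f : 'cV[R]_n -> R) (x : 'cV[R]_n) : 'cV[R]_n :=
  \col_i 'D_(delta_mx i 0) f x.

(* Two-sided differentiability at t = 0 loses nothing: the values of y at
   negative times are unconstrained, so a one-sided solution extends affinely. *)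
Definition gradient_flow n (f : 'cV[R]_n -> R) (x0 : 'cV[R]_n)
    (y : R -> 'cV[R]_n) : Prop :=
  y 0 = x0 /\ forall t : R, 0 <= t -> is_derive t 1 y (- gradient f (y t)).

End Optimization.

Section MatrixCompletion.
Context {R : realType} {n : nat}.
Implicit Types (M N : 'M[R]_n) (Om : {set 'I_n * 'I_n}) (g : 'M[R]_n -> R).

Definition mask Om M : 'M[R]_n :=
  \matrix_(i, j) (if (i, j) \in Om then M i j else 0).

Definition supported Om M : Prop := mask Om M = M.

Definition frob_sq M : R := \sum_i \sum_j M i j ^+ 2.

Definition psd M : Prop :=
  M^T = M /\ forall v : 'cV[R]_n, 0 <= (v^T *m M *m v) 0 0.

Definition sparse_rip (delta : R) (r : nat) Om g : Prop :=
  forall M N, (\rank M <= 2 * r)%N -> (\rank N <= 2 * r)%N ->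
    (1 - delta) * frob_sq (mask Om N) <= hessian_quad g (mask Om M) N
      <= (1 + delta) * frob_sq (mask Om N).

(* The measurement set of an instance of the class is determined by the graph
   (it is the edge set E itself), so an instance is given by its ground truth. *)
Definition problem_class (E : {set 'I_n * 'I_n}) (Mstar : 'M[R]_n) : Prop :=
  [/\ psd Mstar, \rank Mstar = 1%N, forall i j, Mstar i j != 0,
      connected_graph E & ~ bipartite E].

Definition objective g Om Mstar (x : 'cV[R]_n) : R :=
  g (mask Om (x *m x^T - Mstar)).

Definition col_of_tuple (t : n.-tuple R) : 'cV[R]_n := \col_i tnth t i.

(* The initial points whose gradient flow converges to a global minimum
   associated with the ground truth. *)
Definition success_set g Om Mstar : set (n.-tuple R) :=
  [set x0 | exists (y : R -> 'cV[R]_n) (xs : 'cV[R]_n),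
     [/\ gradient_flow (objective g Om Mstar) (col_of_tuple x0) y,
         is_argmin setT (objective g Om Mstar) xs,
         xs *m xs^T = Mstar
       & y t @[t --> +oo] --> xs]].

Definition eucl_norm (t : n.-tuple R) : R := Num.sqrt (\sum_i tnth t i ^+ 2).

(* Absolutely continuous and radial: the density with respect to Lebesgue
   measure is a function of the Euclidean norm only. *)
Definition ac_radial (P : probability (n.-tuple R) R) : Prop :=
  exists p : n.-tuple R -> R,
    [/\ measurable_fun setT p, forall t, 0 <= p t,
        forall s t, eucl_norm s = eucl_norm t -> p s = p t
      & forall A, measurable A ->
          P A = (\int[lebesgue_tuple n]_(t in A) (p t)%:E)%E].

End MatrixCompletion.

(* Main.v *)
(* The graph is a star with hub [o] and all self-loops, and the ground truth is
   [z z^T] with [z = a] at the leaves and [z = c a] at the hub, [a] small. The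
   RIP condition bounds the mixed second derivatives of [g] by [delta] through
   polarization, so for [delta <= c / n] the flow is that of the quadratic loss
   up to the error [star_noise]. Consider the leaves that initially carry at
   least the share [k^2 / n] of the energy [|x|^2]. If they make up half of the
   nodes, then two barriers are never crossed by any of them:
     n x_i^2 >= k^2 |x|^2    and    x_i^2 V^K >= v0 a^2 |x|^(2K),
   where [V] is the energy of the leaves. The first keeps the share of the leaf
   as long as [|x|^2] is large compared with [n a^2]; the second keeps the leaf
   away from [0] when [|x|^2] has decayed: only a large hub pushes the leaf down,
   and then the ratio [V / |x|^2] increases. Hence these leaves never change sign,
   and the flow can reach [z] or [- z] only if they all have the same sign.

   A radial distribution gives a cone the proportion of the unit ball that it
   occupies. Averaging over sign flips, at least half of the coordinates being
   large with the same sign has probability at most [2 * 2^-(n/2)], and fewer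
   than half being large has probability [O(2^-n)] when [k] is a small constant. *)
Require Import Defs.
From mathcomp Require Import all_boot all_order all_algebra.
From mathcomp Require Import all_classical all_reals all_analysis.
From mathcomp Require Import measurable_realfun ring lra zify.
Import Order.TTheory GRing.Theory Num.Theory.
Import numFieldNormedType.Exports.
(* [mask] is the masking of matrices, not the one of sequences. *)
Import Defs.
Local Open Scope classical_set_scope.
Local Open Scope ring_scope.

Set Implicit Arguments.
Unset Strict Implicit.
Unset Printing Implicit Defensive.

(** * Barriers for the star system *)

(** For the quadratic loss, and with the hub-leaf couplings of the ground truth dropped, the
    velocity of a leaf is a multiple of [x i], so no leaf changes sign. The obstacle is the term
    [2 * x o * et i], which is not such a multiple and can push a small leaf through 0; a
    quantitative lower bound on the leaves must survive it. The RIP condition controls an entry of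
    the gradient only by [delta] times the sum of the absolute residuals over the graph. With
    [delta <= c / n] this is about [c] times the mean energy per node, up to a hub factor and a
    multiple of [c * a ^+ 2], which is why the share barrier compares [x i ^+ 2] with that mean. The
    constants are fixed in the order [k], [K], [v0], [c]; only [a] depends on the distribution. *)

Lemma share_noise (R : realFieldType) (k c v0 r w h a2 : R) :
  0 < k -> k <= 4^-1 -> 0 < c -> 0 < v0 ->
  48 * c * (2 * v0 + 5) < k ^+ 3 * v0 -> 0 < r -> 0 <= w ->
  h <= c * r ^+ 2 * (1 + 2 * w) + 5 * c * a2 -> v0 * a2 <= r ^+ 2 ->
  0 <= h ->
  h * (2 + w / k + 2 * w) < k ^+ 2 / 8 * (w ^+ 2 * r ^+ 2 + r ^+ 2).
Proof.
move=> k0 k4 c0 v0p Hc r0 w0 hh va h0.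
have r2 : 0 < r ^+ 2 by rewrite exprn_gt0.
have H1 : v0 * h <= c * (2 * v0 + 5) * ((1 + w) * r ^+ 2).
  have : v0 * h <= v0 * (c * r ^+ 2 * (1 + 2 * w) + 5 * c * a2) by rewrite ler_pM2l.
  have : c * (v0 * a2) <= c * r ^+ 2 by rewrite ler_pM2l.
  have : 0 <= c * w * r ^+ 2 by rewrite mulr_ge0 ?(ltW r2)// mulr_ge0// ltW.
  have : 0 <= v0 * c * r ^+ 2 by rewrite !mulr_ge0 ?ltW.
  lra.
have H2 : k * (2 + w / k + 2 * w) <= 3 * (1 + w).
  rewrite !mulrDr mulrCA mulfV ?gt_eqF// mulr1; nra.
have H3 : v0 * k * (h * (2 + w / k + 2 * w)) <=
    (c * (2 * v0 + 5) * ((1 + w) * r ^+ 2)) * (3 * (1 + w)).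
  have -> : v0 * k * (h * (2 + w / k + 2 * w)) =
     (v0 * h) * (k * (2 + w / k + 2 * w)) by ring.
  have ? := divr_ge0 w0 (ltW k0).
  by apply: ler_pM => //; rewrite mulr_ge0// ?ltW//; lra.
have H4 : (1 + w) * r ^+ 2 * (1 + w) <= 2 * (w ^+ 2 * r ^+ 2 + r ^+ 2).
  have : 0 <= (1 - w) ^+ 2 * r ^+ 2 by rewrite mulr_ge0 ?sqr_ge0// ltW.
  by nra.
suff : v0 * k * (h * (2 + w / k + 2 * w)) <
    v0 * k * (k ^+ 2 / 8 * (w ^+ 2 * r ^+ 2 + r ^+ 2)) by rewrite ltr_pM2l// mulr_gt0.
apply: (le_lt_trans H3).
set Z := w ^+ 2 * r ^+ 2 + r ^+ 2 in H4 *.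
have Z0 : 0 < Z by rewrite /Z ltr_wpDl// mulr_ge0 ?sqr_ge0// ltW.
have E0 : 0 < c * (2 * v0 + 5) by rewrite mulr_gt0// addr_gt0// mulr_gt0.
(* The [48] of the hypothesis is this [6], the [3] of [H3] times the [2] of [H4], multiplied by the
   [8] in the goal. *)
apply: (@le_lt_trans _ _ (6 * (c * (2 * v0 + 5)) * Z)).
  have := ler_wpM2l (ltW E0) H4; nra.
have := Hc; rewrite -(ltr_pM2r Z0); nra.
Qed.

(** If the leaves hold half of the energy, Cauchy-Schwarz gives [Q4 >= N * r ^+ 2 / 4], which
    suffices. Otherwise the hub holds the other half, [n >= 8] gives [y2 >= 4 * r ^+ 2], and
    [y2 * V] dominates. *)
Lemma share_main (R : realFieldType) (k n r N V y2 Q4 : R) :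
  0 < k -> k <= 4^-1 -> 8 <= n -> 0 < r -> N = n * r ^+ 2 ->
  N = V + y2 -> 0 <= y2 -> k ^+ 2 * N / 2 <= V -> V ^+ 2 <= n * Q4 ->
  N * (k ^+ 2 / 8 * (y2 + r ^+ 2)) <= Q4 + y2 * V - k ^+ 2 * r ^+ 2 * N.
Proof.
move=> k0 k4 n8 r0 Nr NV y0 kV VQ.
have k2 : k ^+ 2 <= 16^-1.
  have : 0 <= (4^-1 - k) * (4^-1 + k) by apply: mulr_ge0; lra.
  by nra.
have k20 : 0 < k ^+ 2 by rewrite exprn_gt0.
have r2 : 0 < r ^+ 2 by rewrite exprn_gt0.
have n0 : 0 < n by lra.
have N0 : 0 < N by rewrite Nr mulr_gt0.
set s := r ^+ 2 in Nr r2 *; set K := k ^+ 2 in kV k2 k20 *.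
have [hV|hV] := lerP (N / 2) V.
  have Q : N * s / 4 <= Q4.
    rewrite -(ler_pM2l n0) (le_trans _ VQ)//.
    have -> : n * (N * s / 4) = (N / 2) ^+ 2 by rewrite Nr; field.
    by rewrite lerXn2r// ?nnegrE; lra.
  have h1 : y2 * (N / 2) <= y2 * V by rewrite ler_wpM2l.
  have h2 : K * (y2 * N) <= 16^-1 * (y2 * N) by rewrite ler_wpM2r// mulr_ge0// ltW.
  have h3 : K * (s * N) <= 16^-1 * (s * N) by rewrite ler_wpM2r// mulr_ge0// ltW.
  have h4 : 0 < s * N by rewrite mulr_gt0.
  have h5 : 0 <= y2 * N by rewrite mulr_ge0// ltW.
  lra.
have Q : 0 <= Q4 by rewrite -(pmulr_rge0 _ n0) (le_trans _ VQ)// sqr_ge0.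
have h1 : y2 * (K * N / 2) <= y2 * V by rewrite ler_wpM2l.
have h2 : 4 * s <= y2.
  have : 8 * s <= n * s by rewrite ler_pM2r.
  lra.
have h3 : (K * N) * (4 * s) <= (K * N) * y2 by rewrite ler_wpM2l// mulr_ge0// ltW.
have h4 : 0 < K * N * s by rewrite !mulr_gt0.
lra.
Qed.

(** Here [r ^+ 2] is the mean energy per node, [w] the hub in units of [r], [ax] the modulus of the
    leaf, [Q4] the sum of the fourth powers of the leaves; [dq], [dV], [dY] are the speeds of the
    squared leaf, of the leaf energy and of the squared hub. At equality the terms in [a2] cancel up
    to the nonnegative [a2 * y2], and what remains is [share_main] against [share_noise]. *)
Lemma share_barrier (R : realFieldType)
    (k c v0 n r w N V y2 Q4 h a2 X ax dq dV dY : R) :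
  0 < k -> k <= 4^-1 -> 0 < c -> 0 < v0 ->
  48 * c * (2 * v0 + 5) < k ^+ 3 * v0 -> 8 <= n -> 0 < r -> 0 <= w ->
  N = n * r ^+ 2 -> N = V + y2 -> y2 = (w * r) ^+ 2 ->
  k ^+ 2 * N / 2 <= V -> V ^+ 2 <= n * Q4 -> X <= n * r ->
  h <= c * r ^+ 2 * (1 + 2 * w) + 5 * c * a2 -> v0 * a2 <= r ^+ 2 ->
  0 <= h -> 0 <= a2 -> ax = k * r ->
  4 * ax ^+ 2 * (a2 - ax ^+ 2 - y2) - 4 * h * (ax ^+ 2 + w * r * ax) <= dq ->
  dV <= 4 * a2 * V - 4 * Q4 - 4 * y2 * V + 4 * h * (V + w * r * X) ->
  dY <= - 4 * y2 ^+ 2 - 4 * y2 * V + 4 * h * (y2 + w * r * X) ->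
  0 < n * dq - k ^+ 2 * (dV + dY).
Proof.
move=> k0 k4 c0 v0p Hc n8 r0 w0 Nr NV yw kV VQ Xn hh va h0 a0 axE Hq HV HY.
have y0 : 0 <= y2 by rewrite yw sqr_ge0.
have noise := share_noise k0 k4 c0 v0p Hc r0 w0 hh va h0.
have main := share_main k0 k4 n8 r0 Nr NV y0 kV VQ.
have n0 : 0 < n by lra.
have N0 : 0 < N by rewrite Nr mulr_gt0// exprn_gt0.
have hX : h * (w * r * X) <= h * (w * N).
  rewrite ler_wpM2l// -mulrA ler_wpM2l// (le_trans (ler_wpM2l (ltW r0) Xn))//.
  by rewrite Nr; lra.
have knz : k != 0 by rewrite gt_eqF.
have Hq' : 4 * k ^+ 2 * N * (a2 - k ^+ 2 * r ^+ 2 - y2)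
     - 4 * k ^+ 2 * N * (h * (1 + w / k)) <= n * dq.
  rewrite -(ler_pM2l n0) in Hq; apply: le_trans Hq.
  by rewrite axE Nr le_eqVlt; apply/orP; left; apply/eqP; field.
have HVY : dV + dY <= 4 * (a2 * V - Q4 - 2 * y2 * V - y2 ^+ 2 + h * N + 2 * (h * (w * N))).
  have -> : h * N = h * V + h * y2 by rewrite NV mulrDr.
  lra.
have k20 : 0 < k ^+ 2 by rewrite exprn_gt0.
have HVY' := ler_wpM2l (ltW k20) HVY.
have noise' : N * (h * (2 + w / k + 2 * w)) < N * (k ^+ 2 / 8 * (y2 + r ^+ 2)).
  by rewrite ltr_pM2l// yw exprMn.
have fin : 0 < 4 * k ^+ 2 * (Q4 + y2 * V - k ^+ 2 * r ^+ 2 * N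
   - N * (h * (2 + w / k + 2 * w)) + a2 * y2).
  have ay : 0 <= a2 * y2 by rewrite mulr_ge0.
  rewrite mulr_gt0//; first by rewrite mulr_gt0.
  lra.
apply: (lt_le_trans fin).
have -> : 4 * k ^+ 2 * (Q4 + y2 * V - k ^+ 2 * r ^+ 2 * N - N * (h * (2 + w / k + 2 * w)) + a2 * y2)
 = (4 * k ^+ 2 * N * (a2 - k ^+ 2 * r ^+ 2 - y2) - 4 * k ^+ 2 * N * (h * (1 + w / k)))
   - k ^+ 2 * (4 * (a2 * V - Q4 - 2 * y2 * V - y2 ^+ 2 + h * N + 2 * (h * (w * N)))).
  rewrite NV; field; exact: knz.
lra.
Qed.

(** At the floor [a2] and [r ^+ 2] bound each other up to constants, so the noise is at most [c]
    times a constant times [a2 + y2]. [D] collects the coefficients of the barrier, [E] the cost of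
    passing from [r ^+ 2] to [a2]. *)
Lemma floor_noise (R : realFieldType) (k c v0 r w h a2 K : R) :
  0 < k -> k <= 4^-1 -> 0 < c -> 0 < v0 -> 0 < K ->
  2 * c * ((1 + k^-1 + 2 * K + 2 * K / k ^+ 2) *
    ((4 + 5 / v0) / (2 * k ^+ 2) + 5)) < 1 -> 0 < r -> 0 <= w -> 0 < a2 ->
  h <= c * r ^+ 2 * (1 + 2 * w) + 5 * c * a2 -> v0 * a2 <= 2 * r ^+ 2 ->
  k ^+ 2 * r ^+ 2 <= a2 / 2 -> 0 <= h ->
  h * (1 + w / k + 2 * K + 2 * K * w / k ^+ 2) < a2 / 2 + w ^+ 2 * r ^+ 2.
Proof.
move=> k0 k4 c0 v0p K0 Hc r0 w0 a0 hh va kra h0.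
have r2 : 0 < r ^+ 2 by rewrite exprn_gt0.
have k2 : 0 < k ^+ 2 by rewrite exprn_gt0.
have k21 : k ^+ 2 <= 2^-1.
  have : 0 <= (4^-1 - k) * (4^-1 + k) by apply: mulr_ge0; lra.
  by nra.
set D := 1 + k^-1 + 2 * K + 2 * K / k ^+ 2 in Hc *.
set E := (4 + 5 / v0) / (2 * k ^+ 2) + 5 in Hc *.
have kV : 0 < k^-1 by rewrite invr_gt0.
have Kk : 0 < K / k ^+ 2 by rewrite divr_gt0.
have D0 : 0 < D by rewrite /D; lra.
have HD : h * (1 + w / k + 2 * K + 2 * K * w / k ^+ 2) <= D * (h * (1 + w)).
  have -> : h * (1 + w / k + 2 * K + 2 * K * w / k ^+ 2) =
    h * (1 + k^-1 * w + 2 * K + 2 * (K / k ^+ 2) * w).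
    by field; rewrite gt_eqF.
  have -> : D * (h * (1 + w)) = h * (D * (1 + w)) by ring.
  rewrite ler_wpM2l//.
  have -> : D * (1 + w) = (1 + k^-1 * w + 2 * K + 2 * (K / k ^+ 2) * w)
    + (k^-1 + 2 * (K / k ^+ 2) + w + 2 * K * w) by rewrite /D; field; rewrite gt_eqF.
  have : 0 <= K * w by rewrite mulr_ge0// ltW.
  lra.
set y2 := w ^+ 2 * r ^+ 2.
have y0 : 0 <= y2 by rewrite mulr_ge0// ?sqr_ge0.
have vV : 0 < v0^-1 by rewrite invr_gt0.
have va' : a2 <= 2 * (v0^-1 * r ^+ 2).
  by rewrite mulrCA -ler_pdivrMl// invrK.
have aw : a2 * w <= v0^-1 * (r ^+ 2 + y2).
  apply: (@le_trans _ _ (2 * (v0^-1 * r ^+ 2) * w)); first by rewrite ler_wpM2r.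
  have : 0 <= v0^-1 * r ^+ 2 * (1 - w) ^+ 2 by rewrite mulr_ge0 ?sqr_ge0// mulr_ge0// ltW.
  by rewrite /y2; nra.
have rw : r ^+ 2 * (1 + 2 * w) * (1 + w) <= 4 * (r ^+ 2 + y2).
  have : 0 <= r ^+ 2 * (1 - w) ^+ 2 by rewrite mulr_ge0 ?sqr_ge0// ltW.
  have : 0 <= r ^+ 2 * w by rewrite mulr_ge0// ltW.
  by rewrite /y2; nra.
have ra : r ^+ 2 <= a2 / (2 * k ^+ 2).
  by rewrite ler_pdivlMr ?mulr_gt0//; lra.
have hw : h * (1 + w) <= c * (E * (a2 + y2)).
  have w1 : 0 <= 1 + w by lra.
  apply: (le_trans (ler_wpM2r w1 hh)).
  have -> : (c * r ^+ 2 * (1 + 2 * w) + 5 * c * a2) * (1 + w) =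
   c * (r ^+ 2 * (1 + 2 * w) * (1 + w) + 5 * a2 + 5 * (a2 * w)) by ring.
  rewrite ler_wpM2l//; first exact: ltW.
  set F := 4 + 5 / v0.
  have F0 : 0 < F by rewrite /F; lra.
  apply: (@le_trans _ _ (F * (r ^+ 2 + y2) + 5 * a2)).
    by rewrite /F; lra.
  have F1 : F <= F / (2 * k ^+ 2).
    rewrite ler_pdivlMr ?mulr_gt0//.
    have : F * (2 * k ^+ 2) <= F * 1 by rewrite ler_pM2l//; lra.
    lra.
  have F2 := ler_wpM2l (ltW F0) ra.
  have F3 := ler_wpM2r y0 F1.
  have -> : E * (a2 + y2) = F * (a2 / (2 * k ^+ 2)) + F / (2 * k ^+ 2) * y2 + 5 * a2 + 5 * y2.
    by rewrite /E -/F; field; rewrite gt_eqF.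
  lra.
apply: (le_lt_trans HD).
have := ler_wpM2l (ltW D0) hw.
have A0 : 0 < a2 + y2 by lra.
have : 2 * c * (D * E) * (a2 + y2) < 1 * (a2 + y2) by rewrite ltr_pM2r.
lra.
Qed.

(** The conclusion is the logarithmic derivative of [ax ^+ 2 * (V / N) ^+ K], multiplied by
    [ax ^+ 2 * V * N]. Without noise, [y2 * dV - V * dY] is [4 * y2 * (a2 * V + V ^+ 2 - Q4)], at
    least [k ^+ 2 * y2 * V * N]; thus [8 <= K * k ^+ 2] makes the gain at least twice the loss
    [4 * y2] that the hub inflicts on the leaf. *)
Lemma floor_barrier (R : realFieldType)
    (k c v0 n r w N V y2 Q4 h a2 X ax dq dV dY K : R) :
  0 < k -> k <= 4^-1 -> 0 < c -> 0 < v0 -> 8 <= K * k ^+ 2 ->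
  2 * c * ((1 + k^-1 + 2 * K + 2 * K / k ^+ 2) *
    ((4 + 5 / v0) / (2 * k ^+ 2) + 5)) < 1 -> 0 < n -> 0 < r -> 0 <= w ->
  N = n * r ^+ 2 -> N = V + y2 -> y2 = (w * r) ^+ 2 ->
  k ^+ 2 * N / 2 <= V -> V * (k ^+ 2 * N / 4) <= V ^+ 2 - Q4 -> X <= n * r ->
  h <= c * r ^+ 2 * (1 + 2 * w) + 5 * c * a2 -> v0 * a2 <= 2 * r ^+ 2 ->
  0 <= h -> 0 < a2 -> k * r <= ax -> ax ^+ 2 <= a2 / 2 ->
  4 * ax ^+ 2 * (a2 - ax ^+ 2 - y2) - 4 * h * (ax ^+ 2 + w * r * ax) <= dq ->
  4 * a2 * V - 4 * Q4 - 4 * y2 * V - 4 * h * (V + w * r * X) <= dV ->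
  dY <= - 4 * y2 ^+ 2 - 4 * y2 * V + 4 * h * (y2 + w * r * X) ->
  0 < dq * (V * N) + K * ax ^+ 2 * (y2 * dV - V * dY).
Proof.
move=> k0 k4 c0 v0p Kk Hc n0 r0 w0 Nr NV yw kV VQ Xn hh va h0 a0 kax axa Hq HV HY.
have k2 : 0 < k ^+ 2 by rewrite exprn_gt0.
have r2 : 0 < r ^+ 2 by rewrite exprn_gt0.
have K0 : 0 < K by rewrite -(pmulr_lgt0 _ k2); lra.
have ax0 : 0 < ax by rewrite (lt_le_trans _ kax)// mulr_gt0.
have N0 : 0 < N by rewrite Nr mulr_gt0.
have V0 : 0 < V by rewrite (lt_le_trans _ kV)// divr_gt0// mulr_gt0.
have y0 : 0 <= y2 by rewrite yw sqr_ge0.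
have kra : k ^+ 2 * r ^+ 2 <= a2 / 2.
  by rewrite -exprMn (le_trans _ axa)// lerXn2r// nnegrE ltW// mulr_gt0.
have noise := floor_noise k0 k4 c0 v0p K0 Hc r0 w0 a0 hh va kra h0.
have VN : 0 < V * N by rewrite mulr_gt0.
set q := ax ^+ 2 in axa Hq *.
have q0 : 0 < q by rewrite exprn_gt0.
have Hq' : 4 * q * (a2 - q - y2 - h * (1 + w / k)) <= dq.
  apply: le_trans Hq.
  have : w * r * ax <= q * (w / k).
    have -> : q * (w / k) = w * ax * (k^-1 * ax) by rewrite /q; ring.
    have -> : w * r * ax = w * ax * r by ring.
    by rewrite ler_wpM2l//; [rewrite mulr_ge0// ltW | rewrite ler_pdivlMl].
  by move=> /(ler_wpM2l h0); lra.
have hX : h * (w * r * X) <= h * (w * N).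
  rewrite ler_wpM2l// -mulrA ler_wpM2l// (le_trans (ler_wpM2l (ltW r0) Xn))//.
  by rewrite Nr; lra.
have HV' : y2 * (4 * a2 * V - 4 * Q4 - 4 * y2 * V - 4 * (h * V) - 4 * (h * (w * N)))
    <= y2 * dV by rewrite ler_wpM2l// (le_trans _ HV)//; lra.
have HY' : V * dY <= V * (- 4 * y2 ^+ 2 - 4 * y2 * V + 4 * (h * y2) + 4 * (h * (w * N))).
  by rewrite ler_pM2l// (le_trans HY)//; lra.
have VQ' := ler_wpM2l y0 VQ.
have hw0 : 0 <= h * w by rewrite mulr_ge0.
have NV2 : h * w * (N * N) <= h * w * (2 / k ^+ 2 * (V * N)).
  rewrite ler_wpM2l// mulrA ler_pM2r// mulrAC ler_pdivlMr// mulrC; lra.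
have yV : h * (y2 * V) <= h * (V * N).
  by rewrite ler_wpM2l// mulrC ler_pM2l// NV lerDr ltW.
have diff : 4 * (y2 * (V * (k ^+ 2 * N / 4)) - 2 * (h * (V * N))
    - h * w * (2 / k ^+ 2 * (V * N))) <= y2 * dV - V * dY.
  have ya : 0 <= a2 * (y2 * V) by rewrite !mulr_ge0// ltW.
  have hwN : h * w * (N * N) = y2 * (h * (w * N)) + V * (h * (w * N)).
    by rewrite {2}NV; ring.
  lra.
have diff' := ler_wpM2l (ltW (mulr_gt0 K0 q0)) diff.
have dqVN : 4 * q * (a2 - q - y2 - h * (1 + w / k)) * (V * N) <= dq * (V * N).
  by rewrite ler_pM2r.
have KK : 8 * (q * (y2 * (V * N))) <= K * k ^+ 2 * (q * (y2 * (V * N))).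
  by rewrite ler_wpM2r// !mulr_ge0// ltW.
have noise' : (q * (V * N)) * (h * (1 + w / k + 2 * K + 2 * K * w / k ^+ 2))
   < (q * (V * N)) * (a2 / 2 + y2).
  by rewrite ltr_pM2l ?mulr_gt0// yw exprMn.
have qq : q * (q * (V * N)) <= a2 / 2 * (q * (V * N)).
  by rewrite ler_wpM2r// !mulr_ge0// ltW.
apply: lt_le_trans (lerD dqVN diff').
have -> : 4 * q * (a2 - q - y2 - h * (1 + w / k)) * (V * N) +
  K * q * (4 * (y2 * (V * (k ^+ 2 * N / 4)) - 2 * (h * (V * N)) - h * w * (2 / k ^+ 2 * (V * N))))
 = 4 * ((a2 * (q * (V * N)) - q * (q * (V * N)) - q * (y2 * (V * N)))
   + K * k ^+ 2 * (q * (y2 * (V * N))) / 4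
   - (q * (V * N)) * (h * (1 + w / k + 2 * K + 2 * K * w / k ^+ 2))).
  by field; rewrite gt_eqF.
lra.
Qed.

(** The share barrier guarantees [V / N >= k ^+ 2 / 2], so [v0] is half of the guaranteed value of
    [(V / N) ^+ K]. This has two effects: the floor holds strictly as soon as [x i ^+ 2 >= a2 > 0],
    and on the floor [x i ^+ 2 <= a2 / 2]. *)
Lemma constants_exist (R : archiRealFieldType) (k : R) : 0 < k ->
  exists (K : nat) (c v0 : R),
    [/\ 8 <= K%:R * k ^+ 2, 0 < c <= 1, 0 < v0, 2 * v0 = (k ^+ 2 / 2) ^+ K &
     48 * c * (2 * v0 + 5) < k ^+ 3 * v0 /\
     2 * c * ((1 + k^-1 + 2 * K%:R + 2 * K%:R / k ^+ 2) *
      ((4 + 5 / v0) / (2 * k ^+ 2) + 5)) < 1].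
Proof.
move=> k0; have k2 : 0 < k ^+ 2 by rewrite exprn_gt0.
have [K HK] : exists K : nat, 8 / k ^+ 2 <= K%:R.
  exists (Num.bound (8 / k ^+ 2)); rewrite ltW// archi_boundP// ltW// divr_gt0//.
pose v0 : R := (k ^+ 2 / 2) ^+ K / 2.
have v00 : 0 < v0 by rewrite divr_gt0// exprn_gt0// divr_gt0.
set B := (1 + k^-1 + 2 * K%:R + 2 * K%:R / k ^+ 2) * ((4 + 5 / v0) / (2 * k ^+ 2) + 5).
have B0 : 0 < B.
  have K0 : 0 <= K%:R :> R by [].
  have kV : 0 < k^-1 by rewrite invr_gt0.
  have vV : 0 < v0^-1 by rewrite invr_gt0.
  have ? : 0 <= K%:R / k ^+ 2 by rewrite divr_ge0// ltW.
  have ? : 0 < (4 + 5 / v0) / (2 * k ^+ 2) by rewrite divr_gt0// ?mulr_gt0//; lra.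
  by apply: mulr_gt0; lra.
pose A1 := 48 * (2 * v0 + 5); have A0 : 0 < A1 by rewrite /A1; lra.
pose A2 := k ^+ 3 * v0; have A20 : 0 < A2 by rewrite mulr_gt0// exprn_gt0.
(* The division by [3] leaves room for the strict inequalities and for the factor [2] in the last of
   them. *)
pose c := Num.min 1 (Num.min (A2 / A1) B^-1) / 3.
have c3 : 0 < 3 * c.
  by rewrite mulrC divfK ?pnatr_eq0// !lt_min ltr01 divr_gt0//= invr_gt0.
have c31 : 3 * c <= 1 by rewrite mulrC divfK ?pnatr_eq0// ge_min lexx.
have c3A : 3 * c * A1 <= A2.
  rewrite -ler_pdivlMr// mulrC divfK ?pnatr_eq0// !ge_min; by rewrite lexx !orbT.
have c3B : 3 * c * B <= 1.
  rewrite -ler_pdivlMr// div1r mulrC divfK ?pnatr_eq0// !ge_min; by rewrite lexx !orbT.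
have c0 : 0 < c by lra.
exists K, c, v0; split => //.
- by rewrite -ler_pdivrMr.
- by rewrite c0; lra.
- by rewrite mulrC divfK// pnatr_eq0.
- split; last by rewrite -/B; have := mulr_gt0 c0 B0; lra.
  by have := mulr_gt0 c0 A0; rewrite /A1 /A2 in c3A *; lra.
Qed.

(** Cauchy-Schwarz, from the squares of [f i - m]. The factor is the size of all of [T], hub
    included, to match the [n] of the barriers. *)
Lemma sqr_sum_le (R : realFieldType) (T : finType) (P : pred T) (f : T -> R) :
  (\sum_(i | P i) f i) ^+ 2 <= #|T|%:R * \sum_(i | P i) f i ^+ 2.
Proof.
have [T0|T0] := posnP #|T|.
  rewrite big_pred0 ?expr0n ?T0 ?mul0r//= => i.
  by have := card0_eq T0 i; rewrite inE.
have n0 : 0 < #|T|%:R :> R by rewrite ltr0n.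
set S := \sum_(i | P i) f i; pose m := S / #|T|%:R.
have : \sum_(i | P i) (2 * m * f i - m ^+ 2) <= \sum_(i | P i) f i ^+ 2.
  apply: ler_sum => i _; have := sqr_ge0 (f i - m); nra.
rewrite sumrB -mulr_sumr -/S sumr_const => H.
have : m ^+ 2 *+ #|P| <= m ^+ 2 * #|T|%:R.
  by rewrite -[_ *+ _]mulr_natr ler_wpM2l ?sqr_ge0// ler_nat max_card.
have Sm : S = m * #|T|%:R by rewrite /m divfK// gt_eqF.
move=> H'; apply: (@le_trans _ _ (#|T|%:R * (m ^+ 2 * #|T|%:R))).
  by rewrite Sm exprMn; lra.
rewrite ler_pM2l// (le_trans _ H)//.
have -> : 2 * m * S = 2 * (m ^+ 2 * #|T|%:R) by rewrite Sm; ring.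
lra.
Qed.

(** * Energies, speeds and barriers of the star system *)

Section star.
Variables (R : rcfType) (T : finType) (o : T).
Implicit Types (x th et : T -> R) (i : T) (G : {set T}).

Definition leaf_energy x := \sum_(i | i != o) x i ^+ 2.
Definition energy x := \sum_i x i ^+ 2.
Definition leaf_abs x := \sum_(i | i != o) `|x i|.
Definition star_noise (c a2 : R) x :=
  c / #|T|%:R * (energy x + 2 * `|x o| * leaf_abs x) + 5 * c * a2.

(* The velocity of the gradient flow for the quadratic loss, where [th] and [et]
   collect the deviation of the loss from the quadratic one and the couplings of
   the hub to the leaves in the ground truth. *)
Definition star_velocity (a2 : R) th et x i : R :=
  if i == o then - (2 * x o * (x o ^+ 2 + th o) +
                    2 * \sum_(j | j != o) x j * (x j * x o + et j))
  else - (2 * x i * (x i ^+ 2 - a2 + th i) + 2 * x o * (x i * x o + et i)).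

Lemma energyE x : energy x = leaf_energy x + x o ^+ 2.
Proof. by rewrite /energy (bigD1 o)//= addrC. Qed.

Lemma energy_ge0 x : 0 <= energy x.
Proof. by apply: sumr_ge0 => i _; exact: sqr_ge0. Qed.

Definition share_gap (k : R) x i := #|T|%:R * x i ^+ 2 - k ^+ 2 * energy x.

Definition floor_gap (v0 a2 : R) (K : nat) x i :=
  x i ^+ 2 * leaf_energy x ^+ K - v0 * a2 * energy x ^+ K.

Lemma leaf_energy_ge (k : R) G x :
  o \notin G -> (0 < #|T| <= 2 * #|G|)%N -> (forall i, i \in G -> 0 <= share_gap k x i) ->
  k ^+ 2 * energy x / 2 <= leaf_energy x.
Proof.
move=> oG /andP[T0 TG] sG; have n0 : 0 < #|T|%:R :> R by rewrite ltr0n.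
have N0 := energy_ge0 x.
have k2 := sqr_ge0 k.
apply: (@le_trans _ _ (\sum_(i in G) x i ^+ 2)); last first.
  rewrite /leaf_energy (bigID (mem G) (fun i => i != o))/= -[leLHS]addr0 lerD//.
    rewrite le_eqVlt; apply/orP; left; apply/eqP; apply: eq_bigl => i.
    by case: eqP => //= ->; rewrite (negbTE oG).
  by apply: sumr_ge0 => i _; exact: sqr_ge0.
apply: (@le_trans _ _ (\sum_(i in G) k ^+ 2 * energy x / #|T|%:R)).
  rewrite sumr_const -[leRHS]mulr_natr -[leRHS]mulrA.
  rewrite ler_wpM2l//; first exact: mulr_ge0.
  rewrite mulrC ler_pdivlMr// mulrC ler_pdivrMr// -natrM ler_nat mulnC//.
by apply: ler_sum => i /sG; rewrite subr_ge0 ler_pdivrMr// [_ * _%:R]mulrC.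
Qed.

(** For time 0: when [a2] is small against the mean energy, the share barrier alone implies the
    floor, with a factor 2 to spare. *)
Lemma floor_gap_gt0 (k v0 a2 : R) (K : nat) G x i :
  0 < k -> 0 < v0 -> 2 * v0 = (k ^+ 2 / 2) ^+ K ->
  o \notin G -> (0 < #|T| <= 2 * #|G|)%N -> (forall i, i \in G -> 0 <= share_gap k x i) ->
  a2 <= k ^+ 2 * energy x / #|T|%:R -> i \in G -> x i != 0 ->
  0 < floor_gap v0 a2 K x i.
Proof.
move=> k0 v0p v0E oG TG sG aN iG xi0.
have n0 : 0 < #|T|%:R :> R by case/andP: TG => T0 _; rewrite ltr0n.
have q0 : 0 < x i ^+ 2 by rewrite exprn_even_gt0.
have kV := leaf_energy_ge oG TG sG.
have N0 : 0 < energy x.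
  rewrite /energy (bigD1 i)//= ltr_pwDl//.
  by apply: sumr_ge0 => j _; exact: sqr_ge0.
have aq : a2 <= x i ^+ 2.
  by rewrite (le_trans aN)// ler_pdivrMr// [leRHS]mulrC; have := sG i iG; rewrite subr_ge0.
rewrite subr_gt0; have NK : 0 < energy x ^+ K by rewrite exprn_gt0.
have H : 2 * v0 * energy x ^+ K <= leaf_energy x ^+ K.
  have kN : 0 <= k ^+ 2 / 2 * energy x by rewrite ltW// mulr_gt0// divr_gt0// exprn_gt0.
  rewrite v0E -exprMn lerXn2r// ?nnegrE//.
    by apply: sumr_ge0 => j _; exact: sqr_ge0.
  by rewrite mulrAC.
apply: (@lt_le_trans _ _ (x i ^+ 2 * (2 * v0 * energy x ^+ K))); last by rewrite ler_pM2l.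
apply: (@le_lt_trans _ _ (v0 * x i ^+ 2 * energy x ^+ K)).
  by rewrite ler_pM2r// ler_pM2l.
by have := mulr_gt0 (mulr_gt0 q0 v0p) NK; lra.
Qed.

Section bounds.
Variables (a2 h : R) (th et x : T -> R).
Hypotheses (thh : forall i, `|th i| <= h) (eth : forall i, `|et i| <= h).

Let v := star_velocity a2 th et x.

Lemma noise_mul (u s t : R) : `|t| <= h -> `|u| <= s -> `|u * t| <= h * s.
Proof. by move=> th' us; rewrite normrM mulrC ler_pM. Qed.

(** [2 * x i * v i] is the derivative of [x i ^+ 2]. In the error, the part from [et] keeps a single
    factor [x i]; this is the dangerous one near 0. *)
Lemma leaf_speed i : i != o ->
  `|2 * x i * v i - 4 * x i ^+ 2 * (a2 - x i ^+ 2 - x o ^+ 2)| <=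
    4 * h * (x i ^+ 2 + `|x o| * `|x i|).
Proof.
move=> io; rewrite /v /star_velocity (negbTE io).
have -> : 2 * x i * - (2 * x i * (x i ^+ 2 - a2 + th i) + 2 * x o * (x i * x o + et i))
   - 4 * x i ^+ 2 * (a2 - x i ^+ 2 - x o ^+ 2) =
  - (4 * ((x i ^+ 2) * th i + (x o * x i) * et i)) by ring.
rewrite normrN normrM (ger0_norm (ler0n R 4)) -[leRHS]mulrA ler_pM2l// (le_trans (ler_normD _ _))//.
rewrite mulrDr lerD//; apply: noise_mul; rewrite ?normrM//.
by rewrite -expr2 real_normK// num_real.
Qed.

Lemma hub_speed :
  `|2 * x o * v o - (- 4 * (x o ^+ 2) ^+ 2 - 4 * x o ^+ 2 * leaf_energy x)| <=
    4 * h * (x o ^+ 2 + `|x o| * leaf_abs x).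
Proof.
rewrite /v /star_velocity eqxx.
have -> : \sum_(j | j != o) x j * (x j * x o + et j) =
    x o * leaf_energy x + \sum_(j | j != o) x j * et j.
  rewrite /leaf_energy mulr_sumr -big_split/=; apply: eq_bigr => j _; ring.
set Z := \sum_(j | _) _; set W := leaf_energy x.
have -> : 2 * x o * - (2 * x o * (x o ^+ 2 + th o) + 2 * (x o * W + Z)) -
    (- 4 * (x o ^+ 2) ^+ 2 - 4 * x o ^+ 2 * W) =
   - (4 * ((x o ^+ 2) * th o + x o * Z)) by ring.
rewrite normrN normrM (ger0_norm (ler0n R 4)) -[leRHS]mulrA ler_pM2l// (le_trans (ler_normD _ _))//.
rewrite mulrDr lerD//; first by apply: noise_mul => //; rewrite ger0_norm// sqr_ge0.
rewrite normrM mulrCA ler_wpM2l// (le_trans (ler_norm_sum _ _ _))//.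
by rewrite /leaf_abs mulr_sumr ler_sum// => j _; exact: noise_mul.
Qed.

Lemma leaves_speed :
  `|\sum_(i | i != o) 2 * x i * v i - (4 * a2 * leaf_energy x
     - 4 * \sum_(i | i != o) (x i ^+ 2) ^+ 2 - 4 * x o ^+ 2 * leaf_energy x)| <=
    4 * h * (leaf_energy x + `|x o| * leaf_abs x).
Proof.
have -> : 4 * a2 * leaf_energy x - 4 * (\sum_(i | i != o) (x i ^+ 2) ^+ 2)
    - 4 * x o ^+ 2 * leaf_energy x =
    \sum_(i | i != o) 4 * x i ^+ 2 * (a2 - x i ^+ 2 - x o ^+ 2).
  by rewrite /leaf_energy !mulr_sumr -!sumrB; apply: eq_bigr => i _; ring.
rewrite -sumrB (le_trans (ler_norm_sum _ _ _))//.
rewrite /leaf_energy /leaf_abs mulr_sumr -big_split/= mulr_sumr.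
by apply: ler_sum => i; exact: leaf_speed.
Qed.

End bounds.

Section barrier.
Variables (k c v0 a2 : R) (K : nat).
Hypotheses (k0 : 0 < k) (k4 : k <= 4^-1) (c0 : 0 < c) (v0p : 0 < v0)
  (Kk : 8 <= K%:R * k ^+ 2) (v0E : 2 * v0 = (k ^+ 2 / 2) ^+ K)
  (c1 : 48 * c * (2 * v0 + 5) < k ^+ 3 * v0)
  (c2 : 2 * c * ((1 + k^-1 + 2 * K%:R + 2 * K%:R / k ^+ 2) *
     ((4 + 5 / v0) / (2 * k ^+ 2) + 5)) < 1)
  (T8 : (8 <= #|T|)%N) (a0 : 0 < a2).

Variables (G : {set T}) (x th et : T -> R).
Hypotheses (Go : o \notin G) (G2 : (#|T| <= 2 * #|G|)%N)
  (xG : forall i, i \in G -> x i != 0)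
  (sG : forall i, i \in G -> 0 <= share_gap k x i)
  (fG : forall i, i \in G -> 0 <= floor_gap v0 a2 K x i).
Let h := star_noise c a2 x.
Hypotheses (thh : forall i, `|th i| <= h) (eth : forall i, `|et i| <= h).
Let v := star_velocity a2 th et x.
Let n : R := #|T|%:R.
Let N := energy x.
Let V := leaf_energy x.
Let y2 := x o ^+ 2.
Let Q4 := \sum_(i | i != o) (x i ^+ 2) ^+ 2.
Let X := leaf_abs x.

Let n8 : 8 <= n. Proof. by rewrite /n (ler_nat R 8). Qed.
Let n0 : 0 < n. Proof. by rewrite (lt_le_trans _ n8). Qed.

Let G_ne i : i \in G -> i != o.
Proof. by apply: contraTneq => ->. Qed.

Let G2' : n <= 2 * #|G|%:R.
Proof. by rewrite /n -natrM ler_nat. Qed.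

Let G_sum (P : pred T) (u : R) : 0 <= u -> (forall i, i \in G -> u <= x i ^+ 2) ->
  u * #|[set i in G | P i]%SET|%:R <= \sum_(i | (i != o) && P i) x i ^+ 2.
Proof.
move=> u0 Gu; rewrite (bigID (mem G))/= -[leLHS]addr0 lerD//; last first.
  by apply: sumr_ge0 => i _; exact: sqr_ge0.
rewrite mulr_natr -sumr_const.
rewrite (eq_bigl (fun i => i \in [set i in G | P i]%SET)); last first.
  move=> i; rewrite inE; case: (boolP (i \in G)) => iG; rewrite ?andbF//.
  by rewrite G_ne// andbT.
by apply: ler_sum => i; rewrite inE => /andP[/Gu].
Qed.

Let share i : i \in G -> k ^+ 2 * N / n <= x i ^+ 2.
Proof. by move=> /sG; rewrite subr_ge0 ler_pdivrMr// [_ * n]mulrC. Qed.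

Let N_ge0 : 0 <= N. Proof. exact: energy_ge0. Qed.

Let kV : k ^+ 2 * N / 2 <= V.
Proof. by apply: (leaf_energy_ge Go) => //; rewrite G2 (leq_trans _ T8). Qed.

Let N0 : 0 < N.
Proof.
have /card_gt0P[i iG] : (0 < #|G|)%N by rewrite -(ltn_pmul2l (isT : 0 < 2)%N) muln0; apply: leq_trans G2; apply: leq_trans T8.
rewrite /N /energy (bigD1 i)//= ltr_pwDl//.
  by rewrite exprn_even_gt0//= xG.
by apply: sumr_ge0 => j _; exact: sqr_ge0.
Qed.

Let V0 : 0 < V.
Proof. by rewrite (lt_le_trans _ kV)// divr_gt0// mulr_gt0// exprn_gt0. Qed.

Let NV : N = V + y2. Proof. exact: energyE. Qed.

Let y20 : 0 <= y2. Proof. exact: sqr_ge0. Qed.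

Let VN : V <= N. Proof. by rewrite NV lerDl. Qed.

(** The right-hand side is the sum of [x i ^+ 2 * (V - x i ^+ 2)] over the leaves, and each
    [V - x i ^+ 2] still contains the energy of at least [#|G| - 1 >= n / 4] leaves of [G]. *)
Let VQ : V * (k ^+ 2 * N / 4) <= V ^+ 2 - Q4.
Proof.
have kN : 0 <= k ^+ 2 * N / n by rewrite divr_ge0 ?(ltW n0)// mulr_ge0// sqr_ge0.
have Vs u : V * u = \sum_(i | i != o) x i ^+ 2 * u by rewrite /V /leaf_energy mulr_suml.
rewrite [V ^+ 2]expr2 !Vs /Q4 -sumrB ler_sum// => i io.
rewrite [X in _ - X]expr2 -mulrBr ler_wpM2l ?sqr_ge0//.
rewrite /V /leaf_energy (bigD1 i io)/= addrAC subrr add0r.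
have := G_sum (predC1 i) kN share; apply: le_trans.
have -> : k ^+ 2 * N / 4 = k ^+ 2 * N / n * (n / 4) by field; rewrite gt_eqF.
rewrite ler_wpM2l//.
have : (#|G| <= #|[set j in G | predC1 i j]%SET| + 1)%N.
  have -> : [set j in G | predC1 i j]%SET = G :\ i.
    by apply/setP => j; rewrite !inE andbC.
  by rewrite (cardsD1 i G) addnC leq_add2l leq_b1.
by rewrite -(ler_nat R) natrD; move: G2' n8; lra.
Qed.

Let floor i : i \in G -> v0 * a2 <= x i ^+ 2.
Proof.
move=> /fG; rewrite subr_ge0 => H.
have VK : 0 < V ^+ K by rewrite exprn_gt0.
rewrite -(ler_pM2r VK) (le_trans _ H)// ler_pM2l ?mulr_gt0//.
by rewrite lerXn2r// ?nnegrE ltW// (lt_le_trans V0).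
Qed.

Let r := Num.sqrt (N / n : R).

Let r2N : N = n * r ^+ 2.
Proof. by rewrite sqr_sqrtr ?divr_ge0 ?(ltW n0)// mulrC divfK// gt_eqF. Qed.

Let r0 : 0 < r. Proof. by rewrite sqrtr_gt0 divr_gt0. Qed.

Let w := `|x o| / r.

Let w0 : 0 <= w. Proof. by rewrite divr_ge0// ltW. Qed.

Let wr : w * r = `|x o|. Proof. by rewrite divfK// gt_eqF. Qed.

Let yw : y2 = (w * r) ^+ 2.
Proof. by rewrite wr real_normK// num_real. Qed.

Let Xn : X <= n * r.
Proof.
have nr0 : 0 <= n * r by rewrite mulr_ge0// ltW.
have X0 : 0 <= X by apply: sumr_ge0.
rewrite -(ler_pXn2r (isT : 0 < 2)%N)// ?nnegrE//.
apply: (le_trans (sqr_sum_le _ _)); rewrite exprMn expr2 -mulrA -/n ler_pM2l//.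
rewrite -r2N (le_trans _ VN)// /V /leaf_energy ler_sum// => j _.
by rewrite real_normK// num_real.
Qed.

Let hh : h <= c * r ^+ 2 * (1 + 2 * w) + 5 * c * a2.
Proof.
rewrite /h /star_noise -/n -/N lerD2r r2N -/X -wr.
have -> : c * r ^+ 2 * (1 + 2 * w) = c / n * (n * r ^+ 2 + 2 * (w * r) * (n * r)).
  by field; rewrite gt_eqF.
rewrite ler_wpM2l ?divr_ge0 ?(ltW n0) ?(ltW c0)// lerD2l ler_wpM2l//.
by rewrite mulr_ge0// mulr_ge0// ltW.
Qed.

Let h0 : 0 <= h. Proof. by rewrite (le_trans _ (thh o)). Qed.

(** The floor, summed over [G], bounds the mean energy from below. The part of the noise
    proportional to [a2] thereby compares with [r ^+ 2]. *)
Let a2r : v0 * a2 <= 2 * r ^+ 2.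
Proof.
have va : 0 <= v0 * a2 by rewrite mulr_ge0// ltW.
have := G_sum predT va floor; rewrite (eq_bigl (fun i => i != o)); last first.
  by move=> i; rewrite andbT.
rewrite (_ : [set i in G | predT i]%SET = G); last first.
  by apply/setP => i; rewrite inE andbT.
rewrite -/(leaf_energy x) -/V => H.
rewrite -(ler_pM2l n0).
have H1 : v0 * a2 * n <= v0 * a2 * (2 * #|G|%:R) by rewrite ler_wpM2l.
by move: VN r2N; lra.
Qed.

Let dV := \sum_(i | i != o) 2 * x i * v i.

Lemma share_gap_barrier i : i \in G -> share_gap k x i = 0 ->
  0 < n * (2 * x i * v i) - k ^+ 2 * (dV + 2 * x o * v o).
Proof.
move=> iG si; have io := G_ne iG.
have axE : `|x i| = k * r.
  apply/eqP; rewrite -(eqrXn2 (isT : 0 < 2)%N)// ?mulr_ge0 ?ltW//.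
  rewrite real_normK ?num_real// exprMn; apply/eqP.
  apply: (mulfI (lt0r_neq0 n0)).
  by move/eqP : si; rewrite subr_eq0 -/n -/N => /eqP ->; rewrite r2N; ring.
have x2 : `|x i| ^+ 2 = x i ^+ 2 by rewrite real_normK// num_real.
(* On the share barrier [x i ^+ 2 = k ^+ 2 * r ^+ 2], so the floor of this single leaf improves on
   the factor 2 of [a2r]. *)
have va : v0 * a2 <= r ^+ 2.
  rewrite (le_trans (floor iG))// -x2 axE exprMn -[leRHS]mul1r ler_wpM2r ?sqr_ge0//.
  by rewrite expr_le1 ?ltW//; move: k4; lra.
move: (leaf_speed a2 x thh eth io) (leaves_speed a2 x thh eth) (hub_speed a2 x thh eth).
rewrite -/v -/dV -/V -/X -/Q4 -/y2 -wr => /ler_normlP[Hq _] /ler_normlP[_ HV] /ler_normlP[_ HY].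
apply: (@share_barrier R k c v0 n r w N V y2 Q4 h a2 X `|x i|) => //.
- exact: sqr_sum_le.
- exact: ltW.
- by rewrite x2; move: Hq; lra.
- by move: HV; lra.
- by move: HY; lra.
Qed.

Lemma floor_gap_barrier i : i \in G -> floor_gap v0 a2 K x i = 0 ->
  0 < 2 * x i * v i * (V * N) +
      K%:R * x i ^+ 2 * (y2 * dV - V * (2 * x o * v o)).
Proof.
move=> iG fi; have io := G_ne iG.
have x2 : `|x i| ^+ 2 = x i ^+ 2 by rewrite real_normK// num_real.
have kax : k * r <= `|x i|.
  have kr0 : 0 <= k * r by rewrite mulr_ge0// ltW.
  rewrite -(ler_pXn2r (isT : 0 < 2)%N)// ?nnegrE//.
  rewrite x2 exprMn (le_trans _ (share iG))// r2N le_eqVlt; apply/orP; left.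
  by apply/eqP; field; rewrite gt_eqF.
(* On the floor, [(V / N) ^+ K >= 2 * v0] forces this bound; it leaves half of the growth rate [a2]
   of the leaf to beat the noise. *)
have axa : `|x i| ^+ 2 <= a2 / 2.
  rewrite x2; have NK : 0 < N ^+ K by rewrite exprn_gt0.
  have : x i ^+ 2 * (2 * v0 * N ^+ K) <= v0 * a2 * N ^+ K.
    move/eqP : fi; rewrite subr_eq0 -/V -/N => /eqP <-.
    rewrite ler_wpM2l ?sqr_ge0// v0E -exprMn lerXn2r// ?nnegrE ?(ltW V0)//.
      by rewrite mulr_ge0// divr_ge0// sqr_ge0.
    by rewrite (le_trans _ kV)//; lra.
  rewrite mulrA ler_pM2r// => H.
  by rewrite -(ler_pM2l v0p); move: H; lra.
move: (leaf_speed a2 x thh eth io) (leaves_speed a2 x thh eth) (hub_speed a2 x thh eth).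
rewrite -/v -/dV -/V -/X -/Q4 -/y2 -wr => /ler_normlP[Hq _] /ler_normlP[HV _] /ler_normlP[_ HY].
rewrite -x2.
apply: (@floor_barrier R k c v0 n r w N V y2 Q4 h a2 X `|x i|) => //.
- by rewrite x2; move: Hq; lra.
- by move: HV; lra.
- by move: HY; lra.
Qed.

End barrier.
End star.

(** First exit: let [s] be the infimum of the times at which some [F i <= 0]. Since [I] is finite,
    some [F i] vanishes at [s], and by continuity no [F j] is negative there. The barrier condition
    then gives [F i] a positive derivative, although it is positive just before [s]. *)
Lemma barrier_family (R : realType) (I : finType) (F F' : I -> R -> R) :
  (forall i (t : R), 0 <= t -> is_derive t 1 (F i) (F' i t)) ->
  (forall i, 0 < F i 0) ->
  (forall t : R, 0 <= t -> (forall i, 0 <= F i t) ->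
     forall i, F i t = 0 -> 0 < F' i t) ->
  forall t : R, 0 <= t -> forall i, 0 < F i t.
Proof.
move=> dF F0 bar t1 t10 i1; rewrite ltNge; apply/negP => Fi1.
have cF i (t : R) : 0 <= t -> {for t, continuous (F i)}.
  by move=> t0; apply: differentiable_continuous; apply/derivable1_diffP; case: (dF i t t0).
pose A : set R := [set t | 0 <= t /\ exists i, F i t <= 0].
have At1 : A t1 by split => //; exists i1.
have lbA : has_lbound A by exists 0 => t [].
have hiA : has_inf A by split => //; exists t1.
pose s : R := inf A.
have s0 : 0 <= s by apply: lb_le_inf; [exists t1|move=> t []].
have Fpos (t : R) i : 0 <= t -> t < s -> 0 < F i t.
  move=> t0 ts; rewrite ltNge; apply/negP => Fi; move: ts; rewrite ltNge => /negP; apply.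
  by apply: ge_inf => //; split => //; exists i.
have [[i Fis]|/forallNP Fs] := pselect (exists i, F i s <= 0); last first.
  have : \forall t \near nbhs s, forall i, 0 < F i t.
    apply: (@filter_forall _ _ (fun i t => 0 < F i t)) => i; apply: (cvgr_gt _ (cF i s s0)).
    by rewrite ltNge; exact/negP.
  move=> /nbhs_ballP[e /= e0 He].
  have : exists2 t, A t & t < s + e.
    exact: (inf_adherent e0 hiA).
  case=> t At te; have st : s <= t by apply: ge_inf.
  have [_ [j]] := At; apply/negP; rewrite -ltNge; apply: He.
  by rewrite /ball/= distrC ger0_norm ?subr_ge0// ltrBlDl.
have sp : 0 < s.
  rewrite lt_neqAle s0 andbT eq_sym; apply/eqP => s00.
  by move: Fis; rewrite s00 leNgt F0.
have Fge j : 0 <= F j s.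
  rewrite leNgt; apply/negP => Fjs.
  have : \forall t \near s, F j t < 0 by apply: (cvgr_lt _ (cF j s s0)).
  move=> /nbhs_ballP[e /= e0 He].
  pose d := Num.min (e / 2) (s / 2).
  have d0 : 0 < d by rewrite lt_min !divr_gt0.
  have : F j (s - d) < 0.
    apply: He; rewrite /ball/= opprB addrC subrK ger0_norm ?ltW// gt_min.
    by apply/orP; left; rewrite ltr_pdivrMr// mulr_natr mulr2n ltrDl.
  apply/negP; rewrite -leNgt ltW// Fpos//; last by rewrite ltrBlDl ltrDr.
  by rewrite subr_ge0 ge_min; apply/orP; right; lra.
have Fis0 : F i s = 0 by apply/eqP; rewrite eq_le Fis Fge.
have := bar _ s0 Fge _ Fis0.
have [dFi <-] := dF i s s0 => Dpos.
have := dFi; rewrite /derivable => /cvg_ex[l /= Hl].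
have lE : 'D_1 (F i) s = l by apply: cvg_lim.
rewrite lE in Dpos.
have : \forall h \near 0^', 0 < h^-1 *: (F i (h *: 1 + s) - F i s).
  exact: (cvgr_gt _ Hl).
rewrite /dnbhs /within/= => /nbhs_ballP[e /= e0 He].
pose d := Num.min (e / 2) (s / 2).
have d0 : 0 < d by rewrite lt_min !divr_gt0.
have := He (- d); rewrite /ball/= sub0r opprK oppr_eq0 gt_eqF// Fis0 subr0.
have -> : `|d| < e.
  rewrite ger0_norm ?ltW// gt_min; apply/orP; left; lra.
move=> /(_ isT isT); rewrite invrN scaleNr oppr_gt0 pmulr_rlt0 ?invr_gt0//.
apply/negP; rewrite -leNgt ltW// Fpos//; rewrite /GRing.scale/= mulr1 addrC.
  by rewrite subr_ge0 ge_min; apply/orP; right; lra.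
by rewrite ltrBlDl ltrDr.
Qed.

Section derive_lemmas.
Variable R : realType.
Implicit Types (f g : R -> R) (t df dg : R).

Lemma is_derive1_mul f g t df dg : is_derive t 1 f df -> is_derive t 1 g dg ->
  is_derive t 1 (fun s => f s * g s) (df * g t + f t * dg).
Proof.
move=> Hf Hg; have -> : df * g t + f t * dg = f t *: dg + g t *: df.
  by rewrite /GRing.scale/=; ring.
exact: is_deriveM.
Qed.

Lemma is_derive1_sqr f t df : is_derive t 1 f df ->
  is_derive t 1 (fun s => f s ^+ 2) (2 * f t * df).
Proof.
move=> Hf; have := is_derive1_mul Hf Hf.
rewrite (_ : (fun s => f s * f s) = (fun s => f s ^+ 2)); last first.
  by apply/funext => s; rewrite expr2.
by move=> H; apply: (is_derive_eq H); ring.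
Qed.

Lemma is_derive1_exp f t df n : is_derive t 1 f df ->
  is_derive t 1 (fun s => f s ^+ n) (n%:R * f t ^+ n.-1 * df).
Proof.
move=> Hf; elim: n => [|n IHn].
  rewrite !mul0r (_ : (fun s => f s ^+ 0) = cst 1); first exact: is_derive_cst.
  by apply/funext => s; rewrite expr0.
rewrite (_ : (fun s => f s ^+ n.+1) = (fun s => f s * f s ^+ n)); last first.
  by apply/funext => s; rewrite exprS.
apply: (is_derive_eq (is_derive1_mul Hf IHn)).
case: n {IHn} => [|n]; rewrite /= ?expr0 ?mul0r ?mulr0; first by ring.
by rewrite !exprS -!natr1; ring.
Qed.

Lemma is_derive1_sum (T : finType) (P : pred T) (f : T -> R -> R) t (df : T -> R) :
  (forall i, is_derive t 1 (f i) (df i)) ->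
  is_derive t 1 (fun s => \sum_(i | P i) f i s) (\sum_(i | P i) df i).
Proof.
move=> Hf; elim: (index_enum T) => [|j s IHs].
  rewrite big_nil (_ : (fun _ => _) = cst 0); first exact: is_derive_cst.
  by apply/funext => u; rewrite big_nil.
rewrite (_ : (fun _ => _) =
    (fun u => (if P j then f j u else 0) + \sum_(i <- s | P i) f i u)); last first.
  by apply/funext => u; rewrite big_cons; case: ifP => // _; rewrite add0r.
rewrite (_ : \sum_(i <- j :: s | P i) df i =
    (if P j then df j else 0) + \sum_(i <- s | P i) df i); last first.
  by rewrite big_cons; case: ifP => // _; rewrite add0r.
by apply: is_deriveD => //; case: ifP => // _; exact: is_derive_cst.
Qed.

End derive_lemmas.

Lemma star_flow_neq0 (R : realType) (T : finType) (o : T)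
    (k c v0 a2 : R) (K : nat) (G : {set T}) (X : T -> R -> R) :
  0 < k -> k <= 4^-1 -> 0 < c -> 0 < v0 -> 8 <= K%:R * k ^+ 2 ->
  2 * v0 = (k ^+ 2 / 2) ^+ K -> 48 * c * (2 * v0 + 5) < k ^+ 3 * v0 ->
  2 * c * ((1 + k^-1 + 2 * K%:R + 2 * K%:R / k ^+ 2) *
     ((4 + 5 / v0) / (2 * k ^+ 2) + 5)) < 1 ->
  (8 <= #|T|)%N -> 0 < a2 -> o \notin G -> (#|T| <= 2 * #|G|)%N ->
  (forall t : R, 0 <= t -> exists th et : T -> R,
     [/\ forall i, `|th i| <= star_noise o c a2 (X^~ t),
         forall i, `|et i| <= star_noise o c a2 (X^~ t) &
         forall i, is_derive t 1 (X i) (star_velocity o a2 th et (X^~ t) i)]) ->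
  (forall i, i \in G -> 0 < share_gap k (X^~ 0) i) ->
  (forall i, i \in G -> 0 < floor_gap o v0 a2 K (X^~ 0) i) ->
  forall t : R, 0 <= t -> forall i, i \in G -> X i t != 0.
Proof.
move=> k0 k4 c0 v0p Kk v0E c1 c2 T8 a0 Go G2 flow s0 f0.
have K0 : (0 < K)%N.
  by rewrite lt0n; apply/eqP => K0; move: Kk; rewrite K0 mul0r; lra.
pose dX i (t : R) : R := 'D_1 (X i) t.
have dXE i (t : R) : 0 <= t -> is_derive t 1 (X i) (dX i t).
  by move=> /flow[th [et [_ _ /(_ i)]]] H; exact/derivableP.
pose V (t : R) : R := leaf_energy o (X^~ t); pose N (t : R) : R := energy (X^~ t).
pose dV (t : R) : R := \sum_(i | i != o) 2 * X i t * dX i t.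
pose dN (t : R) : R := \sum_i 2 * X i t * dX i t.
have dVE (t : R) : 0 <= t -> is_derive t 1 V (dV t).
  by move=> t0; apply: is_derive1_sum => i; apply: is_derive1_sqr; exact: dXE.
have dNE (t : R) : 0 <= t -> is_derive t 1 N (dN t).
  by move=> t0; apply: is_derive1_sum => i; apply: is_derive1_sqr; exact: dXE.
(* The share and floor gaps both vanish at [x = 0], so alone they do not give the [x i != 0] that
   the barrier lemmas require. The case [None] adds a third barrier that is never touched: when
   [x i != 0], the floor gives [x i ^+ 2 >= v0 * a2], twice the level of this barrier. Indices
   outside [G] get the constant [1]. *)
pose F (p : T * option bool) (t : R) : R := if p.1 \notin G then 1 else
  match p.2 with
  | Some true => share_gap k (X^~ t) p.1
  | Some false => floor_gap o v0 a2 K (X^~ t) p.1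
  | None => X p.1 t ^+ 2 - v0 * a2 / 2
  end.
pose F' (p : T * option bool) (t : R) : R := if p.1 \notin G then 0 else
  let dq := 2 * X p.1 t * dX p.1 t in
  match p.2 with
  | Some true => #|T|%:R * dq - k ^+ 2 * dN t
  | Some false => dq * V t ^+ K + X p.1 t ^+ 2 * (K%:R * V t ^+ K.-1 * dV t)
                 - v0 * a2 * (K%:R * N t ^+ K.-1 * dN t)
  | None => dq
  end.
have va : 0 < v0 * a2 by rewrite mulr_gt0.
have leV (t : R) i : i \in G -> X i t ^+ 2 <= V t.
  move=> iG; rewrite /V /leaf_energy (bigD1 i)/=; last by apply: contraTneq iG => ->.
  by rewrite lerDl; apply: sumr_ge0 => j _; exact: sqr_ge0.
have VN (t : R) : V t <= N t by rewrite /N (energyE o) lerDl sqr_ge0.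
have low i (t : R) : i \in G -> 0 < X i t ^+ 2 -> 0 <= floor_gap o v0 a2 K (X^~ t) i ->
    v0 * a2 <= X i t ^+ 2.
  move=> iG q0; rewrite /floor_gap subr_ge0 -/(V t) -/(N t) => H.
  have V0 : 0 < V t by rewrite (lt_le_trans q0)// leV.
  have VK : 0 < V t ^+ K by rewrite exprn_gt0.
  rewrite -(ler_pM2r VK) (le_trans _ H)// ler_pM2l//.
  by rewrite lerXn2r// ?nnegrE ltW// (lt_le_trans V0).
suff Fpos : forall t : R, 0 <= t -> forall p, 0 < F p t.
  move=> t t0 i iG; have := Fpos t t0 (i, None); rewrite /F /= iG /=.
  by apply: contraTneq => ->; rewrite expr0n/= sub0r oppr_gt0 -leNgt; lra.
apply: (@barrier_family R _ F F').
- move=> [i b] t t0; rewrite /F /F' /=; case: (i \in G) => /=; last exact: is_derive_cst.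
  have dq := is_derive1_sqr (dXE i t t0).
  have cst0 (u : R) : is_derive t (1 : R) (cst u : R -> R) (0 : R) by exact: is_derive_cst.
  case: b => [[]|].
  + have H1 : is_derive t 1 (fun s => share_gap k (X^~ s) i) _ :=
      is_deriveB (is_derive1_mul (cst0 #|T|%:R) dq)
                 (is_derive1_mul (cst0 (k ^+ 2)) (dNE t t0)).
    by apply: (is_derive_eq H1); rewrite !mul0r !add0r.
  + have H1 : is_derive t 1 (fun s => floor_gap o v0 a2 K (X^~ s) i) _ :=
      is_deriveB (is_derive1_mul dq (is_derive1_exp K (dVE t t0)))
        (is_derive1_mul (cst0 (v0 * a2)) (is_derive1_exp K (dNE t t0))).
    by apply: (is_derive_eq H1); rewrite !mul0r !add0r.
  + have H1 : is_derive t 1 (fun s => X i s ^+ 2 - v0 * a2 / 2) _ :=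
      is_deriveB dq (cst0 (v0 * a2 / 2)).
    by apply: (is_derive_eq H1); rewrite subr0.
- move=> [i b]; rewrite /F/=; case: (boolP (i \in G)) => //= iG.
  case: b => [[]|]; [exact: s0|exact: f0|].
  have q0 : 0 < X i 0 ^+ 2.
    rewrite lt_neqAle sqr_ge0 andbT eq_sym; apply: contraTneq (s0 i iG) => q0.
    rewrite /share_gap q0 mulr0 sub0r oppr_gt0 -leNgt mulr_ge0 ?sqr_ge0//.
    exact: energy_ge0.
  by have := low i 0 iG q0 (ltW (f0 i iG)); lra.
- move=> t t0 Fge.
  have xG i : i \in G -> X i t != 0.
    move=> iG; have := Fge (i, None); rewrite /F /= iG /=.
    by apply: contraTneq => ->; rewrite expr0n/= sub0r oppr_ge0 -ltNge; lra.
  have sG i : i \in G -> 0 <= share_gap k (X^~ t) i.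
    by move=> iG; have := Fge (i, Some true); rewrite /F /= iG.
  have fG i : i \in G -> 0 <= floor_gap o v0 a2 K (X^~ t) i.
    by move=> iG; have := Fge (i, Some false); rewrite /F /= iG.
  have [th [et [thh eth dXt]]] := flow t t0.
  have dXv i : dX i t = star_velocity o a2 th et (X^~ t) i.
    by rewrite /dX; have [_ <-] := dXt i.
  have dVv : dV t = \sum_(i | i != o) 2 * X i t * star_velocity o a2 th et (X^~ t) i.
    by apply: eq_bigr => i _; rewrite dXv.
  have dNv : dN t = dV t + 2 * X o t * dX o t by rewrite /dN (bigD1 o)//= addrC.
  move=> [i b]; rewrite /F /F'/=; case: (boolP (i \in G)) => iG /=; last by move/eqP; rewrite oner_eq0.
  case: b => [[]|].
  + move=> si; rewrite dNv dVv !dXv.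
    exact: (share_gap_barrier k0 k4 c0 v0p c1 T8 a0 Go G2 xG sG fG thh eth iG si).
  + move=> fi.
    have := floor_gap_barrier k0 k4 c0 v0p Kk v0E c2 T8 a0 Go G2 xG sG fG thh eth iG fi.
    rewrite -dVv -!dXv -/(V t) -/(N t).
    have q0 : 0 < X i t ^+ 2 by rewrite exprn_even_gt0//= xG.
    have V0 : 0 < V t by rewrite (lt_le_trans q0)// leV.
    have N0 : 0 < N t by rewrite (lt_le_trans V0).
    move: fi => /eqP; rewrite /floor_gap subr_eq0 -/(V t) -/(N t) => /eqP fi.
    have yE : X o t ^+ 2 = N t - V t by rewrite /N (energyE o) -/(V t) addrAC subrr add0r.
    rewrite yE dNv; set Y := (Y in is_true (0 < Y) -> _).
    set Z := (Z in _ -> is_true (0 < Z)) => Y0.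
    (* On the floor [v0 * a2 * N t ^+ K] can be replaced by [X i t ^+ 2 * V t ^+ K]; the derivative
       of the gap then becomes a positive multiple of the logarithmic form of
       [floor_gap_barrier]. *)
    suff E : V t * N t * Z = V t ^+ K * Y.
      by rewrite -(pmulr_rgt0 _ (mulr_gt0 V0 N0)) E mulr_gt0// exprn_gt0.
    rewrite /Y /Z; move: K0 fi; clear; case: K => // L _; rewrite !exprS/= => fi.
    ring: fi.
  + move=> q0; exfalso; have q1 : X i t ^+ 2 = v0 * a2 / 2 by lra.
    have q2 : 0 < X i t ^+ 2 by rewrite q1 divr_gt0.
    by have := low i t iG q2 (fG i iG); lra.
Qed.

(** * Second derivatives and the RIP condition *)

Section clairaut.
Context {R : realType} {V : normedModType R}.
Implicit Types (f g : V -> R) (x u v : V).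

Lemma is_derive_line f x u (s : R) : differentiable f (x + s *: u) ->
  is_derive s 1 (fun t : R => f (x + t *: u)) ('D_u f (x + s *: u)).
Proof.
move=> df; have := diff_derivable (v := u) df.
have E : (fun h : R => h^-1 *: ((f \o shift (x + s *: u)) (h *: u) - f (x + s *: u))) =
  (fun h : R => h^-1 *: (((fun t : R => f (x + t *: u)) \o shift s) (h *: 1) - f (x + s *: u))).
  apply/funext => h /=; congr (_ *: (f _ - _)).
  by rewrite /shift/= scalerDl addrCA /GRing.scale/= mulr1.
by move=> d; split; [rewrite /derivable -E|rewrite /derive -E].
Qed.

Lemma line_MVT f x u (h : R) : (forall z, differentiable f z) -> 0 < h ->
  exists2 s, 0 < s < h & f (x + h *: u) - f x = h * 'D_u f (x + s *: u).
Proof.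
move=> df h0; have dl s := is_derive_line (df (x + s *: u)).
have [s sh] := MVT h0 (fun s _ => dl s) (derivable_within_continuous (fun s _ => ex_derive (is_derive := dl s))).
rewrite scale0r addr0 subr0 => E; exists s; first by move: sh; rewrite in_itv.
by rewrite E mulrC.
Qed.

Lemma differentiable_translate f a x : (forall z, differentiable f z) ->
  differentiable (fun z => f (z + a)) x.
Proof.
move=> df; apply: (@differentiable_comp _ _ _ _ (fun z => z + a) f).
  exact: (@differentiableD _ _ _ id (cst a)).
exact: df.
Qed.

Lemma derive_translate f a x u : 'D_u (fun z => f (z + a)) x = 'D_u f (x + a).
Proof.
have E : (fun h : R => h^-1 *: (((fun z => f (z + a)) \o shift x) (h *: u) - f (x + a))) =
    (fun h : R => h^-1 *: ((f \o shift (x + a)) (h *: u) - f (x + a))).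
  by apply/funext => h /=; rewrite addrA.
by rewrite /derive E.
Qed.

(** The mean value theorem along [u] for the increment of [f] by [h *: v], then along [v] for
    ['D_u f]. The left-hand side is symmetric in [u] and [v], which yields the symmetry of second
    derivatives. *)
Lemma second_difference f x u v (h : R) :
  (forall z, differentiable f z) -> (forall z, differentiable ('D_u f) z) -> 0 < h ->
  exists s t, [/\ 0 < s < h, 0 < t < h &
    f (x + h *: u + h *: v) - f (x + h *: u) - f (x + h *: v) + f x =
    h * (h * 'D_v ('D_u f) (x + s *: u + t *: v))].
Proof.
move=> df ddf h0.
pose F z := f (z + h *: v) - f z.
have dF z : differentiable F z.
  by apply: differentiableB => //; exact: differentiable_translate.
have [s sh Es] := line_MVT x u dF h0.
have DF : 'D_u F (x + s *: u) = 'D_u f (x + s *: u + h *: v) - 'D_u f (x + s *: u).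
  have dl w : derivable (fun z => f (z + h *: v)) w u.
    by apply: diff_derivable; exact: differentiable_translate.
  have df' w : derivable f w u by apply: diff_derivable.
  rewrite /F (deriveB (dl _) (df' _)).
  by rewrite derive_translate.
have [t th Et] := line_MVT (x + s *: u) v ddf h0.
by exists s, t; split => //; rewrite -Et -DF -Es /F addrAC; ring.
Qed.

Lemma clairaut f x u v : class_C2 f -> 'D_v ('D_u f) x = 'D_u ('D_v f) x.
Proof.
move=> [df ddf cf]; apply/eqP; rewrite eq_sym -subr_eq0 -normr_le0.
apply/ler_addgt0Pl => e e0; rewrite addr0.
have /cvgrPdist_lt/(_ (e / 2)) : 'D_v ('D_u f) z @[z --> x] --> 'D_v ('D_u f) x by exact: cf.
have /cvgrPdist_lt/(_ (e / 2)) : 'D_u ('D_v f) z @[z --> x] --> 'D_u ('D_v f) x by exact: cf.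
have e20 : 0 < e / 2 by rewrite divr_gt0.
move=> /(_ e20)/nbhs_ballP[a /= a0 Ha] /(_ e20)/nbhs_ballP[b /= b0 Hb].
pose W := `|u| + `|v| + 1.
have W0 : 0 < W by rewrite ltr_wpDl// addr_ge0.
pose h := Num.min a b / W.
have h0 : 0 < h by rewrite divr_gt0// lt_min a0.
have near_x s t : 0 < s < h -> 0 < t < h -> `|s *: u + t *: v| < Num.min a b.
  move=> /andP[s0 sh] /andP[t0 th].
  rewrite -[ltRHS](divfK (lt0r_neq0 W0)) -/h (le_lt_trans (ler_normD _ _))//.
  rewrite !normrZ !gtr0_norm// /W !mulrDr mulr1.
  have := ler_wpM2r (normr_ge0 u) (ltW sh).
  have := ler_wpM2r (normr_ge0 v) (ltW th).
  by move: h0; lra.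
have [s [t [sh th E1]]] := second_difference x v df (ddf u) h0.
have [t' [s' [th' sh' E2]]] := second_difference x u df (ddf v) h0.
(* Both expansions describe the same second difference, so after cancelling [h] twice the two mixed
   derivatives agree at points near [x]. *)
rewrite (addrAC x (h *: v) (h *: u)) (addrAC (f (x + h *: u + h *: v))) E1 in E2.
have /(mulfI (lt0r_neq0 h0))/(mulfI (lt0r_neq0 h0)) E := E2.
have Z w : `|w| < Num.min a b -> ball x a (x + w) /\ ball x b (x + w).
  have bl (d : R) : `|w| < d -> ball x d (x + w).
    by rewrite -ball_normE /ball_ /= opprD addNKr normrN.
  by rewrite lt_min => /andP[wa wb]; split; exact: bl.
have [_ B1] := Z _ (near_x _ _ sh th).
have N2 := near_x _ _ sh' th'; rewrite addrC in N2.
have [B2 _] := Z _ N2.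
have := Hb _ B1; have := Ha _ B2; rewrite !addrA /= -E.
move: ('D_v ('D_u f) (x + s *: u + t *: v)) ('D_u ('D_v f) x) ('D_v ('D_u f) x).
move=> p q m H1 H2; clear -H1 H2; rewrite (le_trans (ler_distD p _ _))//.
by rewrite [X in _ + X]distrC; lra.
Qed.

End clairaut.

Section derive_linear.
Context {R : realType} {V : normedModType R}.
Implicit Types (f : V -> R) (x u v : V).

Lemma derive_dirD f x u v : differentiable f x ->
  'D_(u + v) f x = 'D_u f x + 'D_v f x.
Proof. by move=> df; rewrite !deriveE// linearD. Qed.

Lemma derive_dirZ f x (a : R) u : differentiable f x -> 'D_(a *: u) f x = a * 'D_u f x.
Proof. by move=> df; rewrite !deriveE// linearZ. Qed.

Lemma derive_dir_sum f x (I : finType) (P : pred I) (a : I -> R) (u : I -> V) :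
  differentiable f x ->
  'D_(\sum_(i | P i) a i *: u i) f x = \sum_(i | P i) a i * 'D_(u i) f x.
Proof.
move=> df; rewrite deriveE// linear_sum; apply: eq_bigr => i _.
by rewrite linearZ deriveE.
Qed.

Lemma second_derive_dirD f x u v (s : R) : class_C2 f ->
  'D_(u + s *: v) ('D_(u + s *: v) f) x =
  'D_u ('D_u f) x + 2 * s * 'D_v ('D_u f) x + s ^+ 2 * 'D_v ('D_v f) x.
Proof.
move=> C2; have [df ddf _] := C2.
pose F := 'D_(u + s *: v) f.
have dF : differentiable F x by exact: ddf.
have der w w' : derivable ('D_w f) x w' by apply: diff_derivable.
have FE w : 'D_w F x = 'D_w ('D_u f) x + s * 'D_w ('D_v f) x.
  have -> : F = 'D_u f + (s \*: 'D_v f).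
    by apply/funext => z; rewrite /F (derive_dirD u (s *: v) (df z)) (derive_dirZ s v (df z)).
  by rewrite (deriveD (der u w) (derivableZ (der v w))) (deriveZ s (der v w)).
apply: (etrans (derive_dirD u (s *: v) dF)); rewrite (derive_dirZ s v dF).
rewrite (FE u) (FE v) -(clairaut x u v C2).
move: ('D_u ('D_u f) x) ('D_v ('D_u f) x) ('D_v ('D_v f) x) => p q r.
by clear; ring.
Qed.

Lemma derive_argmin f (D : set V) u :
  (forall x, differentiable f x) -> is_argmin D f 0 -> (forall t : R, D (t *: u)) ->
  'D_u f 0 = 0.
Proof.
move=> df [D0 minf] Du.
have dl (s : R) := is_derive_line (df (0 + s *: u)).
have [||||] := @derive1_at_min R (fun t : R => f (0 + t *: u)) (- 1) 1 0.
- lra.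
- by move=> t _; by case: (dl t).
- by rewrite in_itv /=; apply/andP; split; lra.
- by move=> t _; rewrite scale0r addr0 minf// add0r.
by move=> _ <-; have [_ ->] := dl 0; rewrite scale0r addr0.
Qed.

End derive_linear.

(** Subtracting the cases [s = 1] and [s = - 1] isolates [4 * b]. *)
Lemma polarization_le (R : realFieldType) (d a b e : R) :
  (forall s : R, (1 - d) * (1 + s ^+ 2) <= a + 2 * s * b + s ^+ 2 * e
      <= (1 + d) * (1 + s ^+ 2)) -> `|b| <= d.
Proof.
move=> H; have /andP[h1 h2] := H 1; have /andP[h3 h4] := H (- 1).
by rewrite ler_norml; apply/andP; split; lra.
Qed.

Section rip_gradient.
Context {R : realType} {n : nat}.
Variables (Om : {set 'I_n * 'I_n}) (g : 'M[R]_n -> R) (delta : R).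
Implicit Types (M N : 'M[R]_n) (p q : 'I_n * 'I_n).

Definition unit_mx p : 'M[R]_n := delta_mx p.1 p.2.

Lemma unit_mxE p i j : unit_mx p i j = ((i, j) == p)%:R.
Proof. by case: p => a b; rewrite mxE xpair_eqE. Qed.

Lemma mask_sum M : mask Om M = \sum_(p in Om) M p.1 p.2 *: unit_mx p.
Proof.
apply/matrixP => i j; rewrite mxE summxE.
have [ij|ij] := boolP ((i, j) \in Om).
  rewrite (bigD1 (i, j))//= mxE unit_mxE eqxx mulr1 big1 ?addr0// => p /andP[_ pij].
  by rewrite mxE unit_mxE eq_sym (negbTE pij) mulr0.
rewrite big1// => p pO; rewrite mxE unit_mxE; case: eqP => [pij|]; rewrite ?mulr0//.
by rewrite pij pO in ij.
Qed.

Lemma maskZ (a : R) M : mask Om (a *: M) = a *: mask Om M.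
Proof. by apply/matrixP => i j; rewrite !mxE; case: ifP; rewrite ?mulr0. Qed.

Lemma mask_supported M : supported Om (mask Om M).
Proof. by apply/matrixP => i j; rewrite !mxE; case: (_ \in _). Qed.

Lemma frob_sqE M : frob_sq M = \sum_p M p.1 p.2 ^+ 2.
Proof. by rewrite /frob_sq pair_bigA. Qed.

Lemma frob_sq_unit2 p q (s : R) : p \in Om -> q \in Om -> p != q ->
  frob_sq (mask Om (unit_mx p + s *: unit_mx q)) = 1 + s ^+ 2.
Proof.
move=> pO qO pq; have E r : mask Om (unit_mx p + s *: unit_mx q) r.1 r.2 =
    if r \in Om then (r == p)%:R + s * (r == q)%:R else 0.
  have sE (A B : 'M[R]_n) i j : (A + s *: B) i j = A i j + s * B i j by rewrite !mxE.
  by rewrite mxE -surjective_pairing sE !unit_mxE -surjective_pairing.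
rewrite frob_sqE (bigD1 p)//= (bigD1 q) 1?eq_sym//= big1 ?addr0.
  by rewrite !E pO qO !eqxx (negbTE pq) eq_sym (negbTE pq) mulr0 mulr1 addr0 add0r expr1n.
by move=> r /andP[rp rq]; rewrite E (negbTE rp) (negbTE rq) mulr0n mulr0 addr0 if_same expr0n.
Qed.

Lemma frob_sq_unit p : p \in Om -> frob_sq (mask Om (unit_mx p)) = 1.
Proof.
move=> pO; rewrite frob_sqE (bigD1 p)//= big1 ?addr0.
  by rewrite mxE -surjective_pairing pO unit_mxE -surjective_pairing eqxx expr1n.
move=> r rp; rewrite mxE unit_mxE -surjective_pairing (negbTE rp) mulr0n if_same.
by rewrite expr0n.
Qed.

Hypotheses (C2 : class_C2 g) (rip : sparse_rip delta 1 Om g).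

Let hess p q M := 'D_(unit_mx q) ('D_(unit_mx p) g) (mask Om M).

Lemma rip_entry_diag p M : (\rank M <= 2)%N -> p \in Om ->
  `|hess p p M - 1| <= delta.
Proof.
move=> rM pO.
have rk : (\rank (unit_mx p) <= 2 * 1)%N by rewrite mxrank_delta.
have := rip rM rk; rewrite (frob_sq_unit pO) !mulr1 /hessian_quad -/(hess p p M).
by rewrite ler_distl.
Qed.

(** The test direction [unit_mx p + s *: unit_mx q] has rank at most 2, just what the RIP condition
    admits for [r = 1]. *)
Lemma rip_entry_off p q M : (\rank M <= 2)%N -> p \in Om -> q \in Om -> p != q ->
  `|hess p q M| <= delta.
Proof.
move=> rM pO qO pq.
have rk s : (\rank (unit_mx p + s *: unit_mx q)%R <= 2 * 1)%N.
  rewrite (leq_trans (mxrank_add _ _))// mxrank_delta.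
  by rewrite (leq_trans (leq_add (leqnn 1) (mxrank_scale _ _)))// mxrank_delta.
apply: (@polarization_le _ _ (hess p p M) _ (hess q q M)) => s.
have := rip rM (rk s); rewrite (frob_sq_unit2 s pO qO pq) /hessian_quad.
by rewrite (second_derive_dirD (mask Om M) (unit_mx p) (unit_mx q) s C2).
Qed.

(** The mean value theorem for one entry of the gradient between the critical point [0] and
    [mask Om M]. The intermediate point is the mask of [s *: M], still of rank at most 2, so the
    Hessian there is entrywise within [delta] of the identity. Entrywise control costs the sum of
    all absolute entries, hence the condition [delta <= c / n]. *)
Lemma rip_gradient p M : (\rank M <= 2)%N -> p \in Om -> is_argmin (supported Om) g 0 ->
  `|'D_(unit_mx p) g (mask Om M) - M p.1 p.2| <=
    delta * \sum_(q in Om) `|M q.1 q.2|.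
Proof.
move=> rM pO g0; have [dg ddg _] := C2.
have G0 : 'D_(unit_mx p) g 0 = 0.
  apply: (derive_argmin dg g0) => t.
  have -> : t *: unit_mx p = mask Om (t *: unit_mx p); last exact: mask_supported.
  apply/matrixP => i j; rewrite !mxE; case: ifP => // ijO.
  have -> : (i == p.1) && (j == p.2) = false; last by rewrite mulr0.
  by apply/negbTE; apply: contraFN ijO; case: p pO => a b /= pO /andP[/eqP-> /eqP->].
have [s s01] := line_MVT 0 (mask Om M) (ddg (unit_mx p)) ltr01.
rewrite !add0r scale1r G0 subr0 mul1r -maskZ => ->.
have rsM : (\rank (s *: M)%R <= 2)%N by rewrite (leq_trans (mxrank_scale _ _)).
rewrite (mask_sum M) derive_dir_sum; last exact: ddg.
have -> : M p.1 p.2 = \sum_(q in Om) M q.1 q.2 * (q == p)%:R.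
  rewrite (bigD1 p)//= eqxx mulr1 big1 ?addr0// => q /andP[_ /negbTE ->].
  by rewrite mulr0.
rewrite -sumrB (le_trans (ler_norm_sum _ _ _))// mulr_sumr ler_sum// => q qO.
rewrite -mulrBr normrM mulrC ler_wpM2r// -/(hess p q (s *: M)).
have [->|qp] := eqVneq q p; first exact: rip_entry_diag.
by rewrite subr0 rip_entry_off// eq_sym.
Qed.

End rip_gradient.

(** * The gradient flow on the star *)

Definition star_graph n (o : 'I_n) : {set 'I_n * 'I_n} :=
  [set p | [|| p.1 == p.2, p.1 == o | p.2 == o]]%SET.

Lemma star_sum (V : nmodType) n (o : 'I_n) (F : 'I_n * 'I_n -> V) :
  \sum_(p in star_graph o) F p =
  \sum_i F (i, i) + \sum_(i | i != o) (F (i, o) + F (o, i)).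
Proof.
have -> : \sum_(p in star_graph o) F p =
    \sum_i \sum_(j | (i, j) \in star_graph o) F (i, j).
  by rewrite pair_big_dep/=; apply: eq_big => -[].
have A : \sum_(j | (o, j) \in star_graph o) F (o, j) = F (o, o) + \sum_(j | j != o) F (o, j).
  rewrite -(bigD1 o (P := xpredT) (F := fun j => F (o, j)))//=.
  by apply: eq_bigl => j; rewrite inE/= eqxx orbT.
have B i : i != o -> \sum_(j | (i, j) \in star_graph o) F (i, j) = F (i, i) + F (i, o).
  move=> io; rewrite (bigD1 i)/=; last by rewrite inE /= eqxx.
  rewrite (bigD1 o)/=; last by rewrite inE /= eqxx !orbT eq_sym.
  rewrite big1 ?addr0// => j; rewrite inE /= (negbTE io) /= => /andP[/andP[]].
  by rewrite eq_sym => /orP[->//|/eqP->]; rewrite eqxx.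
rewrite (bigD1 o)//= A (eq_bigr _ B) [in RHS](bigD1 o)//= !big_split/=.
by rewrite -!addrA; congr (_ + _); rewrite addrC addrA.
Qed.

Section gradient.
Context {R : realType} {n : nat}.
Implicit Types (Om : {set 'I_n * 'I_n}) (Ms : 'M[R]_n) (x v : 'cV[R]_n).

Lemma outer_mxE x v i j : (x *m v^T) i j = x i 0 * v j 0.
Proof. by rewrite mxE big_ord1 mxE. Qed.

Lemma derive_objective (g : 'M[R]_n -> R) Om Ms x v :
  (forall M, differentiable g M) ->
  'D_v (objective g Om Ms) x =
  'D_(mask Om (x *m v^T + v *m x^T)) g (mask Om (x *m x^T - Ms)).
Proof.
move=> dg; pose phi (t : R) : 'M[R]_n := mask Om ((x + t *: v) *m (x + t *: v)^T - Ms).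
have phi0 : phi 0 = mask Om (x *m x^T - Ms) by rewrite /phi scale0r addr0.
pose dphi i j : R := if (i, j) \in Om then x i 0 * v j 0 + v i 0 * x j 0 else 0.
have dphiE i j : is_derive (0 : R) 1 (fun t => phi t i j) (dphi i j).
  rewrite /dphi; case: ifP => ijO; last first.
    have -> : (fun t => phi t i j) = cst 0 by apply/funext => t; rewrite mxE ijO.
    exact: is_derive_cst.
  have lin k : is_derive (0 : R) 1 (fun t : R => x k 0 + t * v k 0) (v k 0).
    have H := is_deriveD (is_derive_cst (x k 0) (0 : R) 1)
      (is_derive1_mul (is_derive_id (0 : R) 1) (is_derive_cst (v k 0) (0 : R) 1)).
    by apply: (is_derive_eq H); rewrite /= mul1r mul0r addr0 add0r.
  have H := is_deriveD (is_derive1_mul (lin i) (lin j)) (is_derive_cst (- Ms i j) (0 : R) 1).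
  have -> : (fun t => phi t i j) = (fun t => (x i 0 + t * v i 0) * (x j 0 + t * v j 0) + - Ms i j).
    apply/funext => t; have xE k : (x + t *: v) k 0 = x k 0 + t * v k 0 by rewrite !mxE.
    rewrite mxE ijO.
    by rewrite mxE outer_mxE !xE mxE.
  by apply: (is_derive_eq H); rewrite !mul0r !addr0 addrC.
have derphi : derivable phi 0 1.
  by apply/derivable_mxP => i j; case: (dphiE i j).
have Dphi : 'D_1 phi 0 = mask Om (x *m v^T + v *m x^T).
  rewrite (derive_mx derphi); apply/matrixP => i j; rewrite mxE.
  have [_ ->] := dphiE i j; rewrite /dphi [RHS]mxE; case: ifP => // _.
  by rewrite mxE !outer_mxE.
have difphi : differentiable phi 0 by exact/derivable1_diffP.
have E : 'D_v (objective g Om Ms) x = 'D_1 (g \o phi) 0.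
  have Ef : (fun h : R => h^-1 *: ((objective g Om Ms \o shift x) (h *: v) - objective g Om Ms x)) =
     (fun h : R => h^-1 *: (((g \o phi) \o shift 0) (h *: 1) - (g \o phi) 0)).
    apply/funext => h /=; rewrite phi0; congr (_ *: (_ - _)).
    have -> : h *: (1 : R) + 0 = h by rewrite addr0 /GRing.scale/= mulr1.
    by rewrite /objective /phi [x + _]addrC.
  by rewrite /derive Ef.
have d1 : 'D_1 phi 0 = 'd phi 0 1 by exact: deriveE.
rewrite E (deriveE _ (differentiable_comp difphi (dg (phi 0)))) (diff_comp difphi (dg (phi 0))).
by rewrite /comp -d1 Dphi -(deriveE _ (dg (phi 0))) phi0.
Qed.

(** The loss need not be invariant under transposition, so the two orientations of an edge
    contribute different partial derivatives; only their sum enters. *)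
Lemma star_gradient (g : 'M[R]_n -> R) (o : 'I_n) Ms x i :
  (forall M, differentiable g M) ->
  let G a b := 'D_(unit_mx (a, b)) g (mask (star_graph o) (x *m x^T - Ms)) in
  gradient (objective g (star_graph o) Ms) x i 0 =
  if i == o then 2 * x o 0 * G o o + \sum_(j | j != o) x j 0 * (G j o + G o j)
  else 2 * x i 0 * G i i + x o 0 * (G i o + G o i).
Proof.
move=> dg G; rewrite mxE derive_objective//.
rewrite (mask_sum _ (x *m (delta_mx i 0)^T + delta_mx i 0 *m x^T)) derive_dir_sum//.
have entry a b : (x *m (delta_mx i 0)^T + delta_mx i 0 *m x^T) a b =
    x a 0 * (b == i)%:R + (a == i)%:R * x b 0.
  by rewrite mxE !outer_mxE !mxE !eqxx !andbT.
rewrite star_sum /=.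
under eq_bigr do rewrite entry -/(G _ _).
under [X in _ + X]eq_bigr do rewrite !entry -/(G _ _) -/(G _ _).
rewrite (bigD1 i)//= eqxx mulr1 mul1r [X in _ + X + _]big1 ?addr0; last first.
  by move=> j /negbTE ->; rewrite mulr0 mul0r addr0 mul0r.
have -> : (x i 0 + x i 0) * G i i = 2 * x i 0 * G i i by ring.
have [io|io] := eqVneq i o.
  rewrite io; congr (_ + _); apply: eq_bigr => j jo.
  by rewrite (negbTE jo) !mulr1 mul0r mulr0 mul1r addr0 add0r mulrDr.
congr (_ + _); rewrite (bigD1 i)//= big1 ?addr0; last first.
  by move=> j /andP[_ /negbTE ->]; rewrite !mulr0 !mul0r !addr0 !mul0r addr0.
by rewrite eqxx !mulr0 mul1r mulr1 mul0r addr0 add0r mulrDr.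
Qed.

End gradient.

Lemma entry_deviation (R : realFieldType) (e1 e2 s1 s2 d ca h : R) :
  `|e1 - s1| <= d -> `|e2 - s2| <= d -> d + `|ca| <= h ->
  `|(e1 + e2) / 2 - (s1 + s2) / 2 + ca| <= h.
Proof.
move=> h1 h2 hd; rewrite (le_trans (ler_normD _ _))// (le_trans _ hd)// lerD2r.
have -> : (e1 + e2) / 2 - (s1 + s2) / 2 = ((e1 - s1) + (e2 - s2)) / 2 by field.
rewrite normrM [ `|2^-1|]ger0_norm ?invr_ge0// ler_pdivrMr//.
by rewrite (le_trans (ler_normD _ _))// mulr_natr mulr2n lerD.
Qed.

Section star_truth.
Context {R : realType} {n : nat}.
Variables (o : 'I_n) (c a : R).
Hypotheses (c0 : 0 < c) (c1 : c <= 1) (a0 : 0 < a).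

(** The class forbids a zero entry at the hub. The factor [c] makes the hub-leaf entries
    [c * a ^+ 2] and the hub loop [(c * a) ^+ 2] small enough to be counted as noise. *)
Definition star_truth : 'cV[R]_n := \col_i (if i == o then c * a else a).

Let z := star_truth.

Lemma mxrank_outer (x : 'cV[R]_n) : (\rank (x *m x^T) <= 1)%N.
Proof. by rewrite (leq_trans (mxrankM_maxl _ _))// rank_leq_col. Qed.

Lemma mxrank_residual (x : 'cV[R]_n) : (\rank (x *m x^T - z *m z^T)%R <= 2)%N.
Proof.
rewrite (leq_trans (mxrank_add _ _))// mxrank_opp.
by rewrite (leq_add (mxrank_outer _) (mxrank_outer _)).
Qed.

Let xr (x : 'cV[R]_n) := fun i => x i 0.

(** All entries of the ground truth are at most [a ^+ 2], over [n] loops and at most [2 * n]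
    oriented edges: hence the [3]. *)
Lemma residual_sum (x : 'cV[R]_n) :
  \sum_(p in star_graph o) `|(x *m x^T - z *m z^T) p.1 p.2| <=
  energy (xr x) + 2 * `|x o 0| * leaf_abs o (xr x) + 3 * n%:R * a ^+ 2.
Proof.
have E i j : `|(x *m x^T - z *m z^T) i j| <= `|x i 0| * `|x j 0| + z i 0 * z j 0.
  have zp k : 0 < z k 0 by rewrite mxE; case: ifP => // _; rewrite mulr_gt0.
  rewrite mxE [X in _ + X]mxE !outer_mxE (le_trans (ler_normB _ _))// normrM.
  by rewrite lerD2l ger0_norm// mulr_ge0// ltW.
have za k : 0 <= z k 0 <= a.
  rewrite mxE; case: ifP => _; last by rewrite lexx ltW.
  by rewrite mulr_ge0 ?(ltW c0) ?(ltW a0)//= ler_piMl// ltW.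
rewrite star_sum/=.
apply: (@le_trans _ _ (\sum_i (x i 0 ^+ 2 + a ^+ 2) +
    \sum_(i | i != o) (2 * `|x o 0| * `|x i 0| + 2 * a ^+ 2))).
  apply: lerD; apply: ler_sum => i _.
    rewrite (le_trans (E _ _))// -expr2 real_normK ?num_real// lerD2l.
    by have /andP[? ?] := za i; rewrite expr2 ler_pM.
  have zo' : z o 0 * z i 0 <= a ^+ 2.
    have /andP[? ?] := za i; have /andP[? ?] := za o.
    by rewrite expr2 ler_pM.
  have zo'' : z i 0 * z o 0 <= a ^+ 2 by rewrite mulrC.
  have := lerD (E i o) (E o i); move: zo' zo''; lra.
have LA : \sum_(i | i != o) 2 * `|x o 0| * `|x i 0| = 2 * `|x o 0| * leaf_abs o (xr x).
  by rewrite mulr_sumr.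
rewrite !big_split/= LA -/(energy (xr x)).
rewrite !sumr_const card_ord -(mulr_natr (a ^+ 2)) -(mulr_natr (2 * a ^+ 2)).
have : 2 * a ^+ 2 * #|[pred i | i != o]|%:R <= 2 * a ^+ 2 * n%:R.
  have aa : 0 <= 2 * a ^+ 2 by rewrite mulr_ge0// sqr_ge0.
  rewrite ler_wpM2l// ler_nat.
  by rewrite (leq_trans (max_card _))// card_ord.
move: (energy (xr x)) (leaf_abs o (xr x)) => u v.
move: (a ^+ 2) (`|x o 0|) (n%:R : R) (#|_|%:R : R) => w e k l; lra.
Qed.

Variables (g : 'M[R]_n -> R) (delta : R).
Hypotheses (C2 : class_C2 g) (d0 : 0 <= delta) (dn : delta <= c / n%:R)
  (g0 : is_argmin (supported (star_graph o)) g 0)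
  (rip : sparse_rip delta 1 (star_graph o) g).

Lemma star_gradient_velocity (x : 'cV[R]_n) : exists th et : 'I_n -> R,
  [/\ forall i, `|th i| <= star_noise o c (a ^+ 2) (xr x),
      forall i, `|et i| <= star_noise o c (a ^+ 2) (xr x) &
      forall i, - gradient (objective g (star_graph o) (z *m z^T)) x i 0 =
        star_velocity o (a ^+ 2) th et (xr x) i].
Proof.
have [dg _ _] := C2.
pose M := x *m x^T - z *m z^T.
pose G i j := 'D_(unit_mx (i, j)) g (mask (star_graph o) M).
have n0 : (0 < n)%N by case: (n) o => [[]|].
pose s := delta * \sum_(p in star_graph o) `|M p.1 p.2|.
(* The residual contributes [3 * c * a ^+ 2] and the couplings one more [c * a ^+ 2], which the [5]
   in [star_noise] covers. *)
have sle : s + c * a ^+ 2 <= star_noise o c (a ^+ 2) (xr x).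
  have sge0 : 0 <= \sum_(p in star_graph o) `|M p.1 p.2| by apply: sumr_ge0.
  have := ler_pM d0 sge0 dn (residual_sum x); rewrite -/s /star_noise card_ord.
  move: (energy (xr x)) (leaf_abs o (xr x)) => u v.
  have ca : 0 <= c * a ^+ 2 by rewrite mulr_ge0 ?sqr_ge0// ltW.
  have -> : c / n%:R * (u + 2 * `|x o 0| * v + 3 * n%:R * a ^+ 2) =
    c / n%:R * (u + 2 * `|x o 0| * v) + 3 * (c * a ^+ 2).
    by field; rewrite pnatr_eq0 -lt0n.
  by move: ca; rewrite /xr; lra.
have GM i j : (i, j) \in star_graph o -> `|G i j - M i j| <= s.
  by move=> ij; exact: (rip_gradient C2 rip (mxrank_residual x) ij g0).
have ME i j : M i j = x i 0 * x j 0 - z i 0 * z j 0.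
  by rewrite mxE [X in _ + X]mxE !outer_mxE.
have zo : z o 0 = c * a by rewrite mxE eqxx.
have zi i : i != o -> z i 0 = a by move=> io; rewrite mxE (negbTE io).
have a20 : 0 <= a ^+ 2 by exact: sqr_ge0.
pose th i := G i i - M i i - (if i == o then (c * a) ^+ 2 else 0).
pose et i := (G i o + G o i) / 2 - (M i o + M o i) / 2 - (if i == o then 0 else c * a ^+ 2).
have diag i : (i, i) \in star_graph o by rewrite inE/= eqxx.
have leaf i : (i, o) \in star_graph o by rewrite inE/= eqxx !orbT.
have hub i : (o, i) \in star_graph o by rewrite inE/= eqxx !orbT.
exists th, et; split.
- move=> i; rewrite /th; have := GM i i (diag i).
  have : (if i == o then (c * a) ^+ 2 else 0) <= c * a ^+ 2.
    case: ifP => _; last by rewrite mulr_ge0// ltW.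
    by rewrite exprMn ler_wpM2r// expr2 ler_piMl// ltW.
  have : 0 <= (if i == o then (c * a) ^+ 2 else 0) by case: ifP => // _; exact: sqr_ge0.
  move: (if i == o then _ else _) (G i i) (M i i) => b u v b0 bc uv.
  rewrite (le_trans (ler_normB _ _))// (le_trans _ sle)// lerD//.
  by rewrite ger0_norm.
- move=> i; rewrite /et; apply: (entry_deviation (GM i o (leaf i)) (GM o i (hub i))).
  rewrite (le_trans _ sle)// lerD2l normrN ger0_norm; case: ifP => // _.
    by rewrite mulr_ge0// ltW.
  by rewrite mulr_ge0// ltW.
move=> i; rewrite star_gradient// /star_velocity -/M.
have [_|io] := eqVneq i o.
  congr (- (_ + _)); first by rewrite /th eqxx ME zo -/(G o o) /xr; ring.
  rewrite mulr_sumr; apply: eq_bigr => j jo.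
  rewrite /et (negbTE jo) !ME zo (zi j jo) -/(G j o) -/(G o j) /xr.
  by move: (G j o) (G o j) => u v; field.
congr (- (_ + _)).
  by rewrite /th (negbTE io) ME (zi i io) -/(G i i) /xr; move: (G i i) => u; ring.
rewrite /et (negbTE io) !ME zo (zi i io) -/(G i o) -/(G o i) /xr.
by move: (G i o) (G o i) => u v; field.
Qed.

End star_truth.

Section failure.
Context {R : realType} {n : nat}.
Variables (o : 'I_n) (k c v0 a : R) (K : nat) (g : 'M[R]_n -> R) (delta : R).
Hypotheses (k0 : 0 < k) (k4 : k <= 4^-1) (c0 : 0 < c) (cle1 : c <= 1) (v0p : 0 < v0)
  (Kk : 8 <= K%:R * k ^+ 2) (v0E : 2 * v0 = (k ^+ 2 / 2) ^+ K)
  (c1 : 48 * c * (2 * v0 + 5) < k ^+ 3 * v0)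
  (c2 : 2 * c * ((1 + k^-1 + 2 * K%:R + 2 * K%:R / k ^+ 2) *
     ((4 + 5 / v0) / (2 * k ^+ 2) + 5)) < 1)
  (n8 : (8 <= n)%N) (a0 : 0 < a).
Hypotheses (C2 : class_C2 g) (d0 : 0 <= delta) (dn : delta <= c / n%:R)
  (g0 : is_argmin (supported (star_graph o)) g 0)
  (rip : sparse_rip delta 1 (star_graph o) g).

Let z := star_truth o c a.

(** The product of the two coordinates starts negative and never vanishes, so its limit is at most
    0. At a point [xs] with [xs *m xs^T = z *m z^T] it would be [a ^+ 2]; working with the product
    treats [z] and [- z] at once. *)
Lemma flow_not_success (t0 : n.-tuple R) (G : {set 'I_n}) i j :
  o \notin G -> (n <= 2 * #|G|)%N -> (forall i, i \in G -> 0 < share_gap k (tnth t0) i) ->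
  a ^+ 2 <= k ^+ 2 * energy (tnth t0) / n%:R -> i \in G -> j \in G ->
  tnth t0 i * tnth t0 j < 0 -> ~ success_set g (star_graph o) (z *m z^T) t0.
Proof.
move=> oG nG sG aN iG jG xij [y [xs [[y0 flow] _ xsz ycv]]].
pose X (l : 'I_n) (t : R) := y t l 0.
have X0 : X^~ 0 = tnth t0 by apply/funext => l; rewrite /X y0 mxE.
have T8 : (8 <= #|'I_n|)%N by rewrite card_ord.
have TG : (#|'I_n| <= 2 * #|G|)%N by rewrite card_ord.
have Xflow t : 0 <= t -> exists th et : 'I_n -> R,
     [/\ forall l, `|th l| <= star_noise o c (a ^+ 2) (X^~ t),
         forall l, `|et l| <= star_noise o c (a ^+ 2) (X^~ t) &
         forall l, is_derive t 1 (X l) (star_velocity o (a ^+ 2) th et (X^~ t) l)].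
  move=> tge; have [th [et [thh eth vE]]] :=
    star_gradient_velocity c0 cle1 a0 C2 d0 dn g0 rip (y t).
  exists th, et; split => // l.
  have [dy Dy] := flow t tge.
  have /derivable_mxP dl := dy; have Dl := derive_mx dy.
  apply: DeriveDef; first exact: dl.
  by move/matrixP : Dl => /(_ l 0); rewrite mxE -vE => <-; rewrite Dy mxE.
have sG0 l : l \in G -> 0 < share_gap k (X^~ 0) l by rewrite X0; exact: sG.
have fG0 l : l \in G -> 0 < floor_gap o v0 (a ^+ 2) K (X^~ 0) l.
  rewrite X0 => lG; apply: (@floor_gap_gt0 _ _ o k v0 _ K G) => //.
  - by rewrite TG card_ord (leq_trans _ n8).
  - by move=> l' l'G; exact/ltW/sG.
  - by rewrite card_ord.
  apply: contraTneq (sG l lG) => x0.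
  by rewrite /share_gap x0 expr0n mulr0 sub0r oppr_gt0 -leNgt mulr_ge0 ?sqr_ge0 ?energy_ge0.
have a20 : 0 < a ^+ 2 by rewrite exprn_gt0.
have Xn0 := star_flow_neq0 k0 k4 c0 v0p Kk v0E c1 c2 T8 a20 oG TG Xflow sG0 fG0.
pose P (t : R) := X i t * X j t.
have cP t : 0 <= t -> {for t, continuous P}.
  move=> tge; have [th [et [_ _ dX]]] := Xflow t tge.
  apply: continuousM; apply: differentiable_continuous; apply/derivable1_diffP.
    by case: (dX i).
  by case: (dX j).
have Pneg t : 0 <= t -> P t < 0.
  move=> tge; rewrite ltNge; apply/negP => Pt.
  have P0 : P 0 < 0 by rewrite /P /X y0 !mxE.
  have [||s] := @IVT R P 0 t 0 tge.
  - apply: continuous_in_subspaceT => s; rewrite inE/= in_itv/= => /andP[s0 _]; exact: cP.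
  - by rewrite ge_min le_max (ltW P0) Pt orbT.
  rewrite in_itv/= => /andP[s0 _] /eqP; apply/negP; rewrite /P mulf_neq0//; exact: Xn0.
have Xcv l : X l t @[t --> +oo] --> xs l 0.
  have cl : {for xs, continuous (fun M : 'cV[R]_n => M l 0)} by exact: coord_continuous.
  exact: (continuous_cvg _ cl ycv).
have Pcv : P t @[t --> +oo] --> xs i 0 * xs j 0 by exact: cvgM.
have : xs i 0 * xs j 0 <= 0.
  apply: (cvgr_to_le Pcv); near=> t; apply/ltW/Pneg.
  by near: t; exact: nbhs_pinfty_ge.
have Gne l : l \in G -> z l 0 = a.
  by move=> lG; rewrite mxE; case: eqP => // lo; rewrite lo (negbTE oG) in lG.
have : (xs *m xs^T) i j = a ^+ 2 by rewrite xsz outer_mxE (Gne i iG) (Gne j jG).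
by rewrite outer_mxE => ->; rewrite leNgt a20.
Unshelve. all: by end_near. Qed.

End failure.

(** * Lebesgue measure of cones *)

Definition image_measure d d' (T : measurableType d) (T' : measurableType d') (R : realType)
    (m : {measure set T -> \bar R}) (f : T -> T') (mf : measurable_fun setT f) :
    {measure set T' -> \bar R} :=
  measure_function_pushforward__canonical__measure_function_Measure m mf.

Section scaling.
Context {R : realType}.
Local Notation leb := (@lebesgue_measure R).

(** By uniqueness of the measure on half-open intervals. Negative [s] is included for the sign flips
    and exchanges the open and closed ends. *)
Lemma lebesgue_measure_scale (s : R) (A : set (measurableTypeR R)) :
  s != 0 -> measurable A ->
  leb (( *%R s : measurableTypeR R -> measurableTypeR R) @^-1` A) = (`|s|^-1%:E * leb A)%E.
Proof.
move=> s0 mA.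
have ms : measurable_fun setT ( *%R s : measurableTypeR R -> measurableTypeR R).
  exact: mulrl_measurable.
have s0' : 0 < `|s| by rewrite normr_gt0.
pose nu := mscale (NngNum (normr_ge0 s)) (image_measure leb ms).
have : leb A = nu A.
  apply: lebesgue_measure_unique => // _ [[a b]] _ <-.
  suff : leb `]a, b]%classic =
    (`|s|%:E * leb (( *%R s : measurableTypeR R -> measurableTypeR R) @^-1` `]a, b]%classic))%E by [].
  have [sp|sn] : 0 < s \/ s < 0 by apply/orP; rewrite orbC -neq_lt.
    rewrite (_ : _ @^-1` _ = [set` `]a / s, b / s]%R]); last first.
      apply/seteqP; split => u /=; rewrite !in_itv /=;
        by rewrite ltr_pdivrMr// ler_pdivlMr// ![u * s]mulrC.
    rewrite !lebesgue_measure_itv/= !lte_fin ltr_pM2r ?invr_gt0//.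
    case: ifP => _; last by rewrite mule0.
    rewrite gtr0_norm// -!EFinB -EFinM; congr (_%:E).
    by rewrite -mulrBl mulrCA mulfV ?mulr1// gt_eqF.
  rewrite (_ : _ @^-1` _ = [set` `[b / s, a / s[%R]); last first.
    apply/seteqP; split => u /=; rewrite !in_itv /=;
      by rewrite ler_ndivrMr// ltr_ndivlMr// ![u * s]mulrC andbC.
  rewrite !lebesgue_measure_itv/= !lte_fin ltr_nM2r ?invr_lt0//.
  case: ifP => _; last by rewrite mule0.
  rewrite ltr0_norm// -!EFinB -EFinM; congr (_%:E).
  by rewrite -mulrBl mulNr mulrCA mulfV ?mulr1 ?opprB// lt_eqF.
move=> ->; rewrite /nu /mscale/= muleA -EFinM mulVf ?gt_eqF//.
by rewrite mul1e.
Qed.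

Definition scale n (l : 'I_n -> R) (t : n.-tuple R) : n.-tuple R :=
  [tuple l i * tnth t i | i < n].

Lemma scale_cons n (l : 'I_n.+1 -> R) (x : R) (t : n.-tuple R) :
  scale l (cons_pair (x, t)) =
  cons_pair (l ord0 * x, scale (fun i => l (lift ord0 i)) t).
Proof.
apply: eq_from_tnth => i; rewrite tnth_mktuple.
case: (unliftP ord0 i) => [j ->|->]; last by rewrite !tnth0.
by rewrite !tnthS tnth_mktuple.
Qed.

Lemma measurable_scale n (l : 'I_n -> R) : measurable_fun setT (scale l).
Proof.
apply/measurable_fun_tnthP => i.
rewrite (_ : _ \o _ = fun t : n.-tuple R => l i * tnth t i); last first.
  by apply/funext => t /=; rewrite tnth_mktuple.
by apply: measurable_funM => //; exact: measurable_tnth.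
Qed.

(** Diagonal maps are all that is needed below: dilations of cones, sign flips, and the stretching
    of selected coordinates. They respect the product structure, so Fubini on the first coordinate
    carries the induction. *)
Lemma lebesgue_tuple_scale n (l : 'I_n -> R) (A : set (n.-tuple R)) :
  (forall i, l i != 0) -> measurable A ->
  lebesgue_tuple n (scale l @^-1` A) = ((\prod_i `|l i|^-1)%:E * lebesgue_tuple n A)%E.
Proof.
elim: n l A => [|n IHn] l A l0 mA.
  rewrite big_ord0 mul1e; congr (lebesgue_tuple _ _); apply/funext => t.
  by rewrite /preimage/= [scale l t]tuple0 [t in RHS]tuple0.
rewrite big_ord_recl.
set l' := fun i => l (lift ord0 i).
have mC : measurable (@cons_pair R n @^-1` A).
  by rewrite -[X in measurable X]setTI; exact: measurable_cons_pair.
pose phi x := lebesgue_tuple n (xsection (@cons_pair R n @^-1` A) x).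
have mphi : measurable_fun setT phi by exact: measurable_fun_xsection.
have phi0 x : (0 <= phi x)%E by [].
have E x : lebesgue_tuple n (xsection (@cons_pair R n @^-1` (scale l @^-1` A)) x) =
    ((\prod_i `|l' i|^-1)%:E * phi (l ord0 * x)%R)%E.
  rewrite /phi -(IHn l' _ (fun i => l0 _)); last exact: measurable_xsection.
  congr (lebesgue_tuple _ _); apply/seteqP; split => t /=;
    by rewrite /xsection/= !inE /preimage/= -scale_cons.
have -> : lebesgue_tuple n.+1 (scale l @^-1` A) =
    (\int[leb]_x lebesgue_tuple n (xsection (@cons_pair R n @^-1` (scale l @^-1` A)) x))%E by [].
have -> : lebesgue_tuple n.+1 A = (\int[leb]_x phi x)%E by [].
under eq_integral do rewrite E.
have ms : measurable_fun setT ( *%R (l ord0) : measurableTypeR R -> measurableTypeR R).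
  exact: mulrl_measurable.
rewrite ge0_integralZl//; last 2 first.
- exact: (measurableT_comp mphi ms).
- by rewrite lee_fin prodr_ge0// => i _; rewrite invr_ge0.
rewrite mulrC EFinM -muleA; congr (_ * _)%E.
have -> : (\int[leb]_x phi (l ord0 * x)%R = \int[image_measure leb ms]_x phi x)%E.
  exact/esym/(ge0_integral_pushforward ms leb measurableT mphi (fun x _ => phi0 x)).
have k0 : 0 <= `|l ord0|^-1 by rewrite invr_ge0.
rewrite -(@ge0_integral_mscale _ _ _ leb setT measurableT (NngNum k0) phi mphi (fun x _ => phi0 x)).
apply: eq_measure_integral => B mB _.
exact: (lebesgue_measure_scale (l0 ord0) mB).
Qed.

End scaling.

Section cones.
Context {R : realType} {n : nat}.
Local Notation leb := (@lebesgue_tuple R n).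
Implicit Types (t : n.-tuple R) (A C : set (n.-tuple R)) (r s : R).

Definition sqnorm t : R := energy (tnth t).

Definition sqball r : set (n.-tuple R) := [set t | sqnorm t < r].

Definition cone C := forall s t, 0 < s -> C (scale (fun=> s) t) <-> C t.

Lemma measurable_sqnorm : measurable_fun setT sqnorm.
Proof.
apply: measurable_sum => i; apply: measurable_funX; exact: measurable_tnth.
Qed.

Lemma measurable_sqball r : measurable (sqball r).
Proof.
rewrite -[X in measurable X]setTI (_ : sqball r = sqnorm @^-1` `]-oo, r[).
  exact: measurable_sqnorm.
by apply/seteqP; split => t; rewrite /sqball/= in_itv.
Qed.

Lemma sqnorm_scale s t : sqnorm (scale (fun=> s) t) = s ^+ 2 * sqnorm t.
Proof.
rewrite /sqnorm /energy mulr_sumr; apply: eq_bigr => i _.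
by rewrite tnth_mktuple exprMn.
Qed.

Lemma cone_sqball C r : 0 < r -> measurable C -> cone C ->
  leb (C `&` sqball r) = ((Num.sqrt r ^+ n)%:E * leb (C `&` sqball 1))%E.
Proof.
move=> r0 mC cC; have sr0 : 0 < Num.sqrt r by rewrite sqrtr_gt0.
pose l := fun _ : 'I_n => (Num.sqrt r)^-1.
have l0 i : l i != 0 by rewrite invr_eq0 gt_eqF.
have := lebesgue_tuple_scale l0 (measurableI _ _ mC (measurable_sqball 1)).
have -> : \prod_i `|l i|^-1 = Num.sqrt r ^+ n.
  by rewrite /l prodr_const card_ord normfV invrK ger0_norm// ltW.
move=> <-.
congr (leb _); rewrite preimage_setI; congr (_ `&` _).
  apply/seteqP; split => t; rewrite /preimage/=.
    by move=> Ct; apply/cC => //; rewrite invr_gt0.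
  by move=> /(cC (Num.sqrt r)^-1); apply; rewrite invr_gt0.
apply/seteqP; split => t; rewrite /preimage/sqball/= sqnorm_scale exprVn sqr_sqrtr ?ltW//;
  by rewrite mulrC ltr_pdivrMr// mul1r.
Qed.

End cones.

Definition unit_box {R : realType} n : set (n.-tuple R) :=
  [set t | forall i, `|tnth t i| <= 1].
Arguments unit_box {R} n.

Lemma measurable_unit_box (R : realType) n : measurable (@unit_box R n).
Proof.
rewrite (_ : unit_box n = \bigcap_(i in [set: 'I_n]) [set t | `|tnth t i| <= 1]); last first.
  by apply/seteqP; split => [t H i _|t H i]; [exact: H|exact: (H i I)].
apply: fin_bigcap_measurable => // i _.
rewrite (_ : mkset _ = setT `&` (fun t : n.-tuple R => tnth t i) @^-1` `[-1, 1]).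
  exact: measurable_tnth.
by rewrite setTI; apply/seteqP; split => t; rewrite /= in_itv/= ler_norml.
Qed.

Lemma lebesgue_tuple_box (R : realType) n :
  lebesgue_tuple n (@unit_box R n) = (2 ^+ n)%:E.
Proof.
elim: n => [|n IHn].
  rewrite (_ : unit_box 0 = setT); last by apply/seteqP; split => // t _ [].
  by rewrite /= diracT.
have -> : lebesgue_tuple n.+1 (@unit_box R n.+1) =
    (@lebesgue_measure R \x lebesgue_tuple n)%E (`[-1, 1]%classic `*` unit_box n).
  rewrite /= /lebesgue_tupleS /pushforward; congr (_ _); apply/seteqP; split => -[x t] /=.
    move=> H; split; first by have := H ord0; rewrite tnth0 in_itv/= ler_norml.
    by move=> i; have := H (lift ord0 i); rewrite tnthS.
  move=> [x1 t1] i; case: (unliftP ord0 i) => [j ->|->]; rewrite ?tnth0 ?tnthS//.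
  by rewrite ler_norml; move: x1; rewrite in_itv.
rewrite product_measure1E//=; last exact: measurable_unit_box.
rewrite IHn lebesgue_measure_itv/= lte_fin.
have -> : (-1 < 1 :> R) by lra.
by rewrite -EFinB -EFinM exprS; congr (_ %:E); ring.
Qed.

Section radial.
Context {R : realType} {n : nat}.
Local Notation leb := (@lebesgue_tuple R n).
Implicit Types (t : n.-tuple R) (A C : set (n.-tuple R)) (r s : R).

Lemma sqball_fin : (leb (sqball (n := n) 1%R) < +oo :> \bar R)%E.
Proof.
apply: (@le_lt_trans _ _ (leb (@unit_box R n))); last by rewrite lebesgue_tuple_box ltry.
apply: le_measure; rewrite ?inE; [exact: measurable_sqball|exact: measurable_unit_box|].
move=> t; rewrite /sqball /sqnorm /energy /= => t1 i.
rewrite -(ler_pXn2r (isT : 0 < 2)%N) ?nnegrE// expr1n real_normK ?num_real// (le_trans _ (ltW t1))//.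
rewrite (bigD1 i)//= lerDl; apply: sumr_ge0 => j _; exact: sqr_ge0.
Qed.

(** The ball contains the cube of half-side [n.+1%:R^-1], because [n < n.+1 ^ 2]. *)
Lemma sqball_gt0 : (0 < leb (sqball (n := n) 1%R) :> \bar R)%E.
Proof.
pose l := fun _ : 'I_n => n.+1%:R : R.
have l0 i : l i != 0 by rewrite pnatr_eq0.
apply: (@lt_le_trans _ _ (leb (scale l @^-1` unit_box n))).
  rewrite (lebesgue_tuple_scale l0 (@measurable_unit_box R n)) lebesgue_tuple_box.
  rewrite -EFinM lte_fin mulr_gt0 ?exprn_gt0// prodr_gt0// => i _.
  by rewrite invr_gt0 normr_gt0.
apply: le_measure; rewrite ?inE; [|exact: measurable_sqball|].
  rewrite -[X in measurable X]setTI; apply: measurable_scale => //.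
  exact: measurable_unit_box.
move=> t; rewrite /preimage /= => H; rewrite /sqball /sqnorm /energy /=.
have n1 : 0 < n.+1%:R :> R by [].
apply: (@le_lt_trans _ _ (\sum_(i < n) (n.+1%:R ^- 2 : R))).
  apply: ler_sum => i _; have := H i; rewrite tnth_mktuple normrM ger0_norm// => Hi.
  rewrite -real_normK ?num_real// -exprVn lerXn2r// ?nnegrE ?invr_ge0//.
  by rewrite -[leRHS]mul1r ler_pdivlMr// mulrC.
rewrite sumr_const card_ord -[_ *+ n]mulr_natr mulrC ltr_pdivrMr ?exprn_gt0// mul1r.
by rewrite -natrX ltr_nat -mulnn leq_pmulr.
Qed.

(** Push Lebesgue measure, restricted to [C] or not, forward along [sqnorm]. By homogeneity the two
    images on the line are proportional on the rays []-oo, r[], hence everywhere. Cross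
    multiplication avoids dividing extended reals. *)
Lemma cone_integral (C : set (n.-tuple R)) (q : R -> R) :
  measurable C -> cone C -> measurable_fun setT q -> (forall r, 0 <= q r) ->
  (leb (sqball 1%R) * \int[leb]_(t in C) (q (sqnorm t))%:E =
   leb (C `&` sqball 1%R) * \int[leb]_t (q (sqnorm t))%:E)%E.
Proof.
move=> mC cC mq q0.
have msq := @measurable_sqnorm R n.
have msq' : measurable_fun setT (sqnorm : n.-tuple R -> measurableTypeR R) by [].
have mq' : measurable_fun setT (EFin \o q : measurableTypeR R -> \bar R).
  exact/measurable_EFinP.
have q0' x : (0 <= (EFin \o q) x)%E by rewrite lee_fin.
have bfin : (leb (sqball 1%R) : \bar R) \is a fin_num.
  by rewrite (ge0_fin_numE (measure_ge0 leb _)); exact: sqball_fin.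
have cfin : (leb (C `&` sqball 1%R) : \bar R) \is a fin_num.
  rewrite (ge0_fin_numE (measure_ge0 leb _)); apply: le_lt_trans sqball_fin.
  by apply: le_measure; rewrite ?inE; [apply: measurableI => //; exact: measurable_sqball|exact: measurable_sqball|exact: subIsetr].
pose mC' : {measure set (n.-tuple R) -> \bar R} := mrestr leb mC.
pose b := NngNum (fine_ge0 (measure_ge0 leb (sqball 1%R))).
pose c := NngNum (fine_ge0 (measure_ge0 leb (C `&` sqball 1%R))).
pose m1 := mscale b (image_measure mC' msq').
pose m2 := mscale c (image_measure leb msq').
have i1 : (\int[m1]_x (EFin \o q) x = leb (sqball 1%R) * \int[leb]_(t in C) (q (sqnorm t))%:E)%E.
  rewrite (ge0_integral_mscale _ measurableT b mq' (fun x _ => q0' x)) /= fineK//.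
  congr (_ * _)%E.
  transitivity (\int[mC']_t (q (sqnorm t))%:E)%E.
    exact: (ge0_integral_pushforward msq' mC' measurableT mq' (fun x _ => q0' x)).
  have N0 : mC' (~` C) = 0%E by rewrite /= /mrestr setICl measure0.
  have mqs : measurable_fun setT (fun t : n.-tuple R => (q (sqnorm t))%:E).
    exact: (measurableT_comp mq' msq').
  rewrite (ge0_negligible_integral (measurableC mC) measurableT mqs (fun t _ => q0' (sqnorm t)) N0).
  rewrite setTD setCK.
  by apply: eq_measure_integral => B mB BC; rewrite /= /mrestr setIidl.
have i2 : (\int[m2]_x (EFin \o q) x =
    leb (C `&` sqball 1%R) * \int[leb]_t (q (sqnorm t))%:E)%E.
  rewrite (ge0_integral_mscale _ measurableT c mq' (fun x _ => q0' x)) /= fineK//.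
  congr (_ * _)%E.
  exact: (ge0_integral_pushforward msq' leb measurableT mq' (fun x _ => q0' x)).
rewrite -i1 -i2; apply: eq_measure_integral => B mB _.
have E (D : set (n.-tuple R)) r : D `&` (sqnorm @^-1` `]-oo, r[) = D `&` sqball r.
  by apply/seteqP; split => t; rewrite /preimage /sqball/= in_itv.
have e1 r : m1 `]-oo, r[%classic = (leb (sqball 1%R) * leb (C `&` sqball r))%E.
  by rewrite /m1 /mscale/= fineK// /pushforward /mrestr setIC E.
apply: (@measure_unique _ R (measurableTypeR R) (@RGenInftyO.G R)
  (fun k => `]-oo, k%:R[%classic) _ _ _ _ m1 m2 _ _ B mB) => //.
- exact: RGenInftyO.measurableE.
- move=> _ _ [x ->] [y ->]; exists (Num.min x y).
  by apply/seteqP; split => z /=; rewrite !in_itv/= lt_min; [move=> [-> ->]|move=> /andP].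
- by move=> k; exists k%:R.
- apply/seteqP; split => // x _; exists (Num.bound `|x|) => //=.
  by rewrite in_itv/= (le_lt_trans (ler_norm _))// archi_boundP.
- move=> _ [r ->].
  have e2 : m2 `]-oo, r[%classic = (leb (C `&` sqball 1%R) * leb (sqball r))%E.
    by rewrite /m2 /mscale/= fineK// /pushforward -[X in leb X]setTI E setTI.
  apply: (etrans (e1 r)); apply: etrans (esym e2).
  have [r0|r0] := ltP 0 r.
    rewrite (cone_sqball r0 mC cC) -[sqball r]setTI (cone_sqball r0 measurableT)// setTI.
    by rewrite muleCA muleA muleC.
  rewrite (_ : sqball r = set0) ?setI0 ?measure0 ?mule0//.
  apply/seteqP; split => // t; rewrite /sqball/= ltNge => /negP; apply.
  by rewrite (le_trans r0)// energy_ge0.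
- move=> k; apply: (le_lt_trans (_ : (_ <= leb (sqball 1%R) * leb (C `&` sqball k%:R))%E)).
    by rewrite le_eqVlt; apply/orP; left; apply/eqP; exact: e1.
  case: k => [|k].
    rewrite (_ : sqball 0%:R = set0) ?setI0 ?measure0 ?mule0//.
    apply/seteqP; split => // t; rewrite /sqball/= ltNge => /negP; apply.
    exact: energy_ge0.
  have k0 : 0 < k.+1%:R :> R by [].
  rewrite (cone_sqball k0 mC cC) -(fineK bfin) -(fineK cfin).
  by rewrite -!EFinM ltry.
Qed.

End radial.

(** * Radial distributions *)

Section radial_cones.
Context {R : realType} {n : nat}.
Local Notation leb := (@lebesgue_tuple R n).
Implicit Types (t : n.-tuple R) (A C : set (n.-tuple R)).

Lemma radial_cone_le (P : probability (n.-tuple R) R) C (q : R) :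
  (0 < n)%N -> ac_radial P -> measurable C -> cone C ->
  (leb (C `&` sqball 1) <= q%:E * leb (sqball 1))%E -> (P C <= q%:E)%E.
Proof.
move=> n0 [p [mp p0 pr PE]] mC cC Cq.
(* A point of squared norm [r] on the first axis: [p \o e] is a measurable radial profile, and [p t]
   is its value at [sqnorm t]. *)
pose e (r : R) : n.-tuple R := [tuple if i == Ordinal n0 then Num.sqrt r else 0 | i < n].
have me : measurable_fun setT e.
  apply/measurable_fun_tnthP => i.
  rewrite (_ : _ \o _ = if i == Ordinal n0 then @Num.sqrt R else cst 0); last first.
    by apply/funext => r /=; rewrite tnth_mktuple; case: ifP.
  case: ifP => _ //; apply: continuous_measurable_fun; exact: sqrt_continuous.
have enorm r : 0 <= r -> sqnorm (e r) = r.
  move=> r0; rewrite /sqnorm /energy (bigD1 (Ordinal n0))//= tnth_mktuple eqxx.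
  rewrite sqr_sqrtr// big1 ?addr0// => i i0.
  by rewrite tnth_mktuple (negbTE i0) expr0n.
have pe t : p (e (sqnorm t)) = p t.
  apply: pr; rewrite /eucl_norm -/(energy _) -/(energy _) -/(sqnorm _) -/(sqnorm _).
  by rewrite enorm// energy_ge0.
have := cone_integral mC cC (measurableT_comp mp me) (fun r => p0 (e r)).
have -> : (\int[leb]_(t in C) ((p \o e) (sqnorm t))%:E = P C)%E.
  by rewrite PE//; apply: eq_integral => t _ /=; rewrite pe.
have -> : (\int[leb]_t ((p \o e) (sqnorm t))%:E = 1)%E.
  by rewrite -(@probability_setT _ _ _ P) PE//; apply: eq_integral => t _ /=; rewrite pe.
rewrite mule1 => E; move: Cq; rewrite -E muleC => H.
have b0 := @sqball_gt0 R n; have bfin : leb (sqball 1) \is a fin_num.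
  by rewrite (ge0_fin_numE (measure_ge0 leb _)); exact: sqball_fin.
by move: H; rewrite lee_pmul2r.
Qed.

Lemma measure_bigsetU_le d (T : measurableType d) (mu : {measure set T -> \bar R})
    (I : finType) (Q : pred I) (A : I -> set T) :
  (forall i, Q i -> measurable (A i)) ->
  (mu (\big[setU/set0]_(i | Q i) A i) <= \sum_(i | Q i) mu (A i))%E.
Proof.
move=> mA; elim: (index_enum I) => [|j s IHs]; first by rewrite !big_nil measure0.
rewrite !big_cons; case: ifP => // Qj.
apply: le_trans (leeD2l _ IHs); apply: measureU2; first exact: mA.
exact: bigsetU_measurable.
Qed.

Definition low_set (k : R) (I : {set 'I_n}) : set (n.-tuple R) :=
  [set t | forall i, i \in I -> n%:R * tnth t i ^+ 2 <= k ^+ 2 * sqnorm t].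

Lemma measurable_low k i :
  measurable [set t : n.-tuple R | n%:R * tnth t i ^+ 2 <= k ^+ 2 * sqnorm t].
Proof.
have m : measurable_fun setT
    (fun t : n.-tuple R => n%:R * tnth t i ^+ 2 - k ^+ 2 * sqnorm t).
  apply: measurable_funB; apply: measurable_funM => //; last exact: measurable_sqnorm.
  by apply: measurable_funX; exact: measurable_tnth.
rewrite -[X in measurable X]setTI.
rewrite (_ : mkset _ = (fun t : n.-tuple R => n%:R * tnth t i ^+ 2 - k ^+ 2 * sqnorm t)
   @^-1` `]-oo, 0]); first exact: m.
by apply/seteqP; split => t; rewrite /preimage/= in_itv/= subr_le0.
Qed.

Lemma measurable_low_set k I : measurable (low_set k I).
Proof.
rewrite (_ : low_set k I = \bigcap_(i in [set` I])
    [set t : n.-tuple R | n%:R * tnth t i ^+ 2 <= k ^+ 2 * sqnorm t]).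
  by apply: fin_bigcap_measurable => // i _; exact: measurable_low.
by apply/seteqP; split => t H i; exact: H.
Qed.

Lemma cone_low_set k I : cone (low_set k I).
Proof.
move=> s t s0; have s2 : 0 < s ^+ 2 by rewrite exprn_gt0.
have E i : (n%:R * tnth (scale (fun=> s) t) i ^+ 2 <= k ^+ 2 * sqnorm (scale (fun=> s) t)) =
    (n%:R * tnth t i ^+ 2 <= k ^+ 2 * sqnorm t).
  by rewrite sqnorm_scale tnth_mktuple exprMn mulrCA [leRHS]mulrCA ler_pM2l.
by split=> H i iI; have := H i iI; rewrite E.
Qed.

(* Stretching the coordinates in [I] by [1 / k] moves [low_set] into a ball of
   twice the radius, which costs [2 ^ n] in volume but gains [k ^ - #|I|]. *)
Lemma leb_low_set k (I : {set 'I_n}) : (0 < n)%N -> 0 < k ->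
  (leb (low_set k I `&` sqball 1) <= (k ^+ #|I| * 2 ^+ n)%:E * leb (sqball 1))%E.
Proof.
move=> n0 k0; pose l i : R := if i \in I then k^-1 else 1.
have l0 i : l i != 0 by rewrite /l; case: ifP => _; rewrite ?oner_eq0// invr_eq0 gt_eqF.
have prodl : \prod_i `|l i|^-1 = k ^+ #|I|.
  rewrite (bigID (mem I))/= [X in _ * X]big1 ?mulr1; last first.
    by move=> i /negbTE iI; rewrite /l iI normr1 invr1.
  rewrite (eq_bigr (fun=> k)) ?prodr_const// => i iI.
  by rewrite /l iI normfV invrK gtr0_norm.
have sq4 : leb (sqball 4) = ((2 ^+ n)%:E * leb (sqball 1))%E.
  have := @cone_sqball R n setT 4 (ltr0n _ 4) measurableT (fun _ _ _ => iff_refl _).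
  rewrite !setTI => ->; congr (_%:E * _)%E; congr (_ ^+ n).
  by rewrite (_ : 4 = 2 ^+ 2) ?sqrtr_sqr ?ger0_norm//; ring.
have := lebesgue_tuple_scale l0 (@measurable_sqball R n 4).
rewrite prodl sq4 muleA -EFinM => <-.
apply: le_measure; rewrite ?inE.
- by apply: measurableI; [exact: measurable_low_set|exact: measurable_sqball].
- rewrite -[X in measurable X]setTI; apply: measurable_scale => //.
  exact: measurable_sqball.
move=> t [tI]; rewrite /sqball /preimage /= => t1.
have nr : 0 < n%:R :> R by rewrite ltr0n.
have k2 : 0 < k ^+ 2 by rewrite exprn_gt0.
apply: (@le_lt_trans _ _ (2 * sqnorm t)); last by lra.
have -> : 2 * sqnorm t = \sum_(i < n) (tnth t i ^+ 2 + sqnorm t / n%:R).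
  rewrite big_split/= sumr_const card_ord -[_ *+ n]mulr_natr divfK ?gt_eqF//.
  by rewrite -/(energy (tnth t)) -/(sqnorm t); ring.
apply: ler_sum => i _; rewrite tnth_mktuple /l; case: ifP => iI.
  rewrite exprMn exprVn ler_wpDl ?sqr_ge0// ler_pdivrMl// mulrA ler_pdivlMr//.
  by rewrite mulrC; exact: tI.
by rewrite mul1r lerDl divr_ge0// energy_ge0.
Qed.

Lemma radial_low_set (P : probability (n.-tuple R) R) k (I : {set 'I_n}) :
  (0 < n)%N -> ac_radial P -> 0 < k -> (P (low_set k I) <= (k ^+ #|I| * 2 ^+ n)%:E)%E.
Proof.
move=> n0 rP k0; apply: (radial_cone_le n0 rP (@measurable_low_set k I) (@cone_low_set k I)).
exact: leb_low_set.
Qed.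

Lemma radial_small_ball (P : probability (n.-tuple R) R) : (0 < n)%N -> ac_radial P ->
  exists2 r, 0 < r & (P (sqball r) <= (2 * 2 ^- n)%:E)%E.
Proof.
move=> n0 rP; pose F k := sqball (n := n) (k.+1%:R^-1 : R).
have mF k : measurable (F k) by exact: measurable_sqball.
have ndF : nonincreasing_seq F.
  move=> k m km; apply/subsetPset => t; rewrite /F /sqball/= => /lt_le_trans; apply.
  by rewrite lef_pV2 ?posrE// ler_nat.
have mcap : measurable (\bigcap_k F k) by exact: bigcapT_measurable.
have P0 : (P (\bigcap_k F k) <= (2 ^- n)%:E)%E.
  (* The intersection is the origin, which lies in every [low_set]. Taking all coordinates and
     [k = 2 ^- 2] bounds its probability by [2 ^- n]; the factor 2 in the goal gives the strict
     inequality that passes to a small ball. *)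
  have k0 : 0 < 2 ^- 2 :> R by rewrite invr_gt0 exprn_gt0.
  apply: (@le_trans _ _ (P (low_set (2 ^- 2) [set: 'I_n]))).
    apply: le_measure; rewrite ?inE//; first exact: measurable_low_set.
    move=> t Ft i _; rewrite -[leRHS]add0r -lerBlDr.
    have -> : n%:R * tnth t i ^+ 2 - 2 ^- 2 ^+ 2 * sqnorm t <= 0; last by [].
    have N0 : sqnorm t <= 0.
      apply/ler_addgt0Pl => e e0; rewrite addr0.
      have [m Hm] : exists m : nat, e^-1 < m%:R.
        by exists (Num.bound e^-1); rewrite archi_boundP// ltW// invr_gt0.
      have m0 : 0 < m%:R :> R by rewrite (lt_trans _ Hm)// invr_gt0.
      have := Ft m I; rewrite /F /sqball /= => /ltW/le_trans; apply.
      rewrite -[leRHS]invrK lef_pV2 ?posrE ?invr_gt0//.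
      by rewrite (le_trans (ltW Hm))// ler_nat.
    have ti : tnth t i ^+ 2 <= sqnorm t.
      rewrite /sqnorm /energy (bigD1 i)//= lerDl.
      by apply: sumr_ge0 => j _; exact: sqr_ge0.
    have s0 : sqnorm t = 0 by apply/eqP; rewrite eq_le N0 energy_ge0.
    rewrite s0 mulr0 subr0; rewrite s0 in ti.
    by rewrite (_ : tnth t i ^+ 2 = 0) ?mulr0//; apply/eqP; rewrite eq_le ti sqr_ge0.
  rewrite (le_trans (radial_low_set [set: 'I_n] n0 rP k0))// lee_fin cardsT card_ord.
  by rewrite -exprMn expr2 invfM mulfVK ?pnatr_eq0// -exprVn.
have Pfin : (P (F 0%N) < +oo)%E by rewrite (le_lt_trans (probability_le1 _ _))// ltry.
have := nonincreasing_cvg_mu Pfin mF mcap ndF.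
have lt2 : (P (\bigcap_k F k) < (2 * 2 ^- n)%:E)%E.
  rewrite (le_lt_trans P0)// lte_fin mulr_natl mulr2n ltrDl invr_gt0 exprn_gt0//.
move=> /(_ [set y | (y < (2 * 2 ^- n)%:E)%E]) H.
have [|m _ Hm] := H _.
  exact: open_ereal_lt'.
exists m.+1%:R^-1; first by rewrite invr_gt0.
exact/ltW/(Hm m (leqnn m)).
Qed.

End radial_cones.

(** * Sign flips and the exceptional set of initial points *)

Section signs.
Context {R : realType} {n : nat}.
Local Notation leb := (@lebesgue_tuple R n).
Implicit Types (t : n.-tuple R) (A C : set (n.-tuple R)) (s : {ffun 'I_n -> bool}).

Definition flip s : n.-tuple R -> n.-tuple R := scale (fun i => (-1) ^+ s i).

Lemma tnth_flip s t i : tnth (flip s t) i = (-1) ^+ s i * tnth t i.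
Proof. by rewrite tnth_mktuple. Qed.

Lemma sqnorm_flip s t : sqnorm (flip s t) = sqnorm t.
Proof.
by apply: eq_bigr => i _; rewrite tnth_flip exprMn sqrr_sign mul1r.
Qed.

Lemma measurable_flip s : measurable_fun setT (flip s).
Proof. exact: measurable_scale. Qed.

Lemma lebesgue_flip s A : measurable A -> leb (flip s @^-1` A) = leb A.
Proof.
move=> mA; rewrite (lebesgue_tuple_scale _ mA); last by move=> i; rewrite signr_eq0.
by rewrite big1 ?mul1e// => i _; rewrite normr_sign invr1.
Qed.

(** Flips preserve both Lebesgue measure and the ball, so the left-hand side is the integral over
    the ball of the number of flips of [t] that land in [C]. *)
Lemma leb_sign_average C (m : nat) : measurable C ->
  (forall t, (#|[pred s | flip s t \in C]| <= m)%N) ->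
  ((2 ^+ n)%:E * leb (C `&` sqball 1) <= m%:R%:E * leb (sqball 1))%E.
Proof.
move=> mC Cm; set B := sqball 1.
have mB : measurable B by exact: measurable_sqball.
have mCB : measurable (C `&` B) by exact: measurableI.
have mF s : measurable (flip s @^-1` (C `&` B)).
  by rewrite -[X in measurable X]setTI; exact: measurable_flip.
have -> : ((2 ^+ n)%:E * leb (C `&` B) = \sum_s \int[leb]_t (\1_(flip s @^-1` (C `&` B)) t)%:E)%E.
  have E s : (\int[leb]_t (\1_(flip s @^-1` (C `&` B)) t)%:E = leb (C `&` B))%E.
    transitivity (leb (flip s @^-1` (C `&` B))); last exact: lebesgue_flip.
    by rewrite (integral_indic leb measurableT (mF s)) setIT.
  have fin : leb (C `&` B) \is a fin_num.
    rewrite (ge0_fin_numE (measure_ge0 leb _)); apply: le_lt_trans (@sqball_fin R n).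
    by apply: le_measure; rewrite ?inE//; exact: subIsetr.
  rewrite (eq_bigr _ (fun s _ => E s)) -(fineK fin) sumEFin sumr_const -EFinM.
  by rewrite card_ffun card_bool card_ord -[X in _ = X%:E]mulr_natl natrX.
have mE s : measurable_fun setT (fun t => (\1_(flip s @^-1` (C `&` B)) t)%:E : \bar R).
  by apply/measurable_EFinP; exact: measurable_indic.
have E0 s t : setT t -> (0 <= (\1_(flip s @^-1` (C `&` B)) t)%:E :> \bar R)%E.
  by move=> _; rewrite lee_fin.
rewrite -(ge0_integral_sum leb measurableT mE E0).
apply: (@le_trans _ _ (\int[leb]_t (m%:R%:E * (\1_B t)%:E))%E).
  apply: ge0_le_integral => //.
  - by move=> t tT; apply: sume_ge0 => s sT; exact: E0.
  - exact: emeasurable_sum.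
  - by apply: measurable_funeM; apply/measurable_EFinP; exact: measurable_indic.
  move=> t tT; rewrite sumEFin -EFinM lee_fin !indicE.
  have E s : \1_(flip s @^-1` (C `&` B)) t = ((flip s t \in C) && (t \in B))%:R :> R.
    rewrite indicE; congr (nat_of_bool _)%:R; apply/idP/andP.
      by rewrite !inE /B /sqball /preimage/= sqnorm_flip.
    by rewrite !inE /B /sqball /preimage/= sqnorm_flip.
  under eq_bigr do rewrite E.
  case: (t \in B); last by rewrite big1 ?mulr0// => s _; rewrite andbF.
  rewrite mulr1; under eq_bigr do rewrite andbT.
  rewrite -natr_sum ler_nat (leq_trans _ (Cm t))//.
  rewrite -sum1_card [leqRHS]big_mkcond/=; apply: leq_sum => s _.
  by rewrite [s \in _]inE; case: (flip s t \in C).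
have mB1 : measurable_fun setT (fun t => (\1_B t)%:E : \bar R).
  by apply/measurable_EFinP; exact: measurable_indic.
have B0 t : setT t -> (0 <= (\1_B t)%:E :> \bar R)%E by rewrite lee_fin.
have m0 : (0 <= m%:R%:E :> \bar R)%E by rewrite lee_fin.
rewrite (ge0_integralZl leb measurableT mB1 B0 m0).
by rewrite integral_indic// setIT.
Qed.

End signs.

Lemma sign_agree (R : realDomainType) (x y : R) (a b : bool) : x != 0 -> y != 0 ->
  0 <= ((-1) ^+ a * x) * ((-1) ^+ b * y) -> a = (b (+) (y < 0)) (+) (x < 0).
Proof.
move=> x0 y0; rewrite leNgt mulr_lt0 !mulr_sign_lt0 x0 y0 !mulf_neq0 ?signr_eq0//=.
by case: a; case: b; case: (x < 0); case: (y < 0).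
Qed.

Section bad_set.
Context {R : realType} {n : nat}.
Variables (o : 'I_n) (k : R).
Local Notation leb := (@lebesgue_tuple R n).
Implicit Types (t : n.-tuple R) (s : {ffun 'I_n -> bool}).

Definition high t : {set 'I_n} :=
  [set i | (i != o) && (k ^+ 2 * sqnorm t < n%:R * tnth t i ^+ 2)]%SET.

Definition aligned : set (n.-tuple R) :=
  [set t | (n <= 2 * #|high t|)%N /\
    forall i j, i \in high t -> j \in high t -> 0 <= tnth t i * tnth t j].

Lemma high_flip s t : high (flip s t) = high t.
Proof.
by apply/setP => i; rewrite !inE sqnorm_flip tnth_flip exprMn sqrr_sign mul1r.
Qed.

Lemma high_scale r t : 0 < r -> high (scale (fun=> r) t) = high t.
Proof.
move=> r0; have r2 : 0 < r ^+ 2 by rewrite exprn_gt0.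
apply/setP => i; rewrite !inE sqnorm_scale tnth_mktuple exprMn.
by rewrite mulrCA [X in _ < X]mulrCA ltr_pM2l.
Qed.

Lemma cone_aligned : cone aligned.
Proof.
move=> r t r0; have r2 : 0 < r ^+ 2 by rewrite exprn_gt0.
have E i j : (0 <= tnth (scale (fun=> r) t) i * tnth (scale (fun=> r) t) j) =
    (0 <= tnth t i * tnth t j).
  by rewrite !tnth_mktuple mulrACA -expr2 pmulr_rge0.
by rewrite /aligned /= high_scale//; split=> -[nh H]; split => // i j ih jh;
  have := H i j ih jh; rewrite E.
Qed.

Lemma measurable_aligned : measurable aligned.
Proof.
have mhigh i : measurable [set t | i \in high t].
  rewrite (_ : mkset _ = if i == o then set0 else
      ~` [set t | n%:R * tnth t i ^+ 2 <= k ^+ 2 * sqnorm t]).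
    by case: ifP => // _; apply: measurableC; exact: measurable_low.
  apply/seteqP; split => t; rewrite /= inE; case: eqP => //= _.
    by rewrite ltNge => /negP.
  by move=> /negP; rewrite ltNge.
have mprod i j : measurable [set t : n.-tuple R | 0 <= tnth t i * tnth t j].
  rewrite -[X in measurable X]setTI.
  rewrite (_ : mkset _ = (fun t => tnth t i * tnth t j) @^-1` `[0, +oo[).
    by apply: measurable_funM => //; exact: measurable_tnth.
  by apply/seteqP; split => t; rewrite /preimage/= in_itv/= andbT.
rewrite (_ : aligned = \big[setU/set0]_(I : {set 'I_n} | (n <= 2 * #|I|)%N)
   ((\bigcap_(i in [set: 'I_n]) (if i \in I then [set t | i \in high t] else ~` [set t | i \in high t]))
   `&` \bigcap_(i in [set` I]) \bigcap_(j in [set` I]) [set t | 0 <= tnth t i * tnth t j])).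
  apply: bigsetU_measurable => I _; apply: measurableI.
    apply: fin_bigcap_measurable => // i _; case: ifP => _ //; exact: measurableC.
  by apply: fin_bigcap_measurable => // i _; exact: fin_bigcap_measurable.
apply/seteqP; split => t.
  move=> [nh H]; rewrite (bigD1 (high t))//=; left; split.
    by move=> i _; case: ifPn => // /negP.
  by move=> i ih j jh; exact: H.
elim/big_ind: _ => //; first by move=> A B HA HB [/HA|/HB].
move=> I nI [Hh HI].
have E : high t = I.
  apply/setP => i; have := Hh i Logic.I; case: ifPn => iI /=; first by move=> ->.
  by move=> /negP/negbTE ->.
by split; rewrite E// => i j iI jI; exact: HI.
Qed.

(** Flips do not move [high t]. On it, the flipped signs must all agree, so [s] is determined there
    by one bit; it is free on the remaining coordinates, at most [n./2] of them. *)
Lemma card_aligned_flips t :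
  (#|[pred s | flip s t \in aligned]| <= 2 * 2 ^ n./2)%N.
Proof.
have [nh|nh] := leqP n (2 * #|high t|); last first.
  rewrite (_ : #|_| = 0%N)//; apply: eq_card0 => s; rewrite !inE.
  by apply/negP; rewrite inE /aligned/= high_flip => -[]; rewrite leqNgt nh.
pose F (b : bool) i : pred bool :=
  if i \in high t then pred1 (b (+) (tnth t i < 0)) else predT.
have cardF b : (#|family (F b)| <= 2 ^ n./2)%N.
  rewrite card_family foldrE big_map.
  have -> : (\prod_(j <- enum 'I_n) #|F b j| = \prod_(j : 'I_n) (if j \in high t then 1 else 2))%N.
    by rewrite big_enum/=; apply: eq_bigr => j _; rewrite /F; case: ifP => _; rewrite ?card1// card_bool.
  rewrite (bigID (mem (high t)))/= big1 ?mul1n; last by move=> i ->.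
  rewrite (eq_bigr (fun=> 2%N)); last by move=> i /negbTE ->.
  rewrite prod_nat_const leq_exp2l//.
  have : (#|high t| + #|[predC high t]| = n)%N by rewrite cardC card_ord.
  by move: nh; rewrite -[#|[predC high t]|]/(#|[pred i | i \notin high t]|) /=; lia.
have tnz i : i \in high t -> tnth t i != 0.
  rewrite inE => /andP[_]; apply: contraTneq => ->.
  by rewrite expr0n mulr0 -leNgt mulr_ge0 ?sqr_ge0 ?energy_ge0.
apply: (@leq_trans (#|family (F true)| + #|family (F false)|)); last first.
  by rewrite mul2n -addnn leq_add.
rewrite -cardUI; apply: leq_trans (leq_addr _ _); apply: subset_leq_card.
apply/fintype.subsetP => s; rewrite [s \in _]inE => /set_mem[_]; rewrite high_flip => H.
rewrite -[s \in _]/((s \in family (F true)) || (s \in family (F false))).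
have [/card0_eq h0|/card_gt0P[g gh]] := posnP #|high t|.
  by apply/orP; left; apply/familyP => i; rewrite /F h0.
have sg i : i \in high t -> s i = (s g (+) (tnth t g < 0)) (+) (tnth t i < 0).
  move=> ih; apply: sign_agree (tnz i ih) (tnz g gh) _.
  by have := H i g ih gh; rewrite !tnth_flip.
have [b bE] : exists b, b = s g (+) (tnth t g < 0) by eexists.
have sF : s \in family (F b).
  apply/familyP => i; rewrite /F; case: ifPn => // ih.
  by rewrite inE (sg i ih) bE.
by apply/orP; case: b sF {bE}; [left|right].
Qed.

End bad_set.

Section bad_set_bound.
Context {R : realType} {n : nat}.
Variables (o : 'I_n) (k : R) (P : probability (n.-tuple R) R).
Hypotheses (k0 : 0 < k) (k6 : k <= 2 ^- 6) (rP : ac_radial P).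

Let n0 : (0 < n)%N. Proof. by case: (n) o => [[]|]. Qed.

Lemma radial_aligned : (P (aligned o k) <= (2 * 2 ^- uphalf n)%:E)%E.
Proof.
apply: (radial_cone_le n0 rP (@measurable_aligned _ _ o k) (@cone_aligned _ _ o k)).
have := leb_sign_average (@measurable_aligned _ _ o k) (card_aligned_flips o k).
have n2 : 0 < 2 ^+ n :> R by rewrite exprn_gt0.
have fin : ((2 ^+ n)^-1%:E : \bar R) \is a fin_num by [].
rewrite -(lee_pmul2l fin) ?lte_fin ?invr_gt0// !muleA -!EFinM mulVf ?gt_eqF// mul1e.
move=> /le_trans; apply; rewrite le_eqVlt; apply/orP; left; apply/eqP.
congr (_%:E * _)%E; rewrite natrM natrX mulrCA; congr (_ * _).
have nE : n = (n./2 + uphalf n)%N.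
  by rewrite uphalf_half addnCA addnn odd_double_half.
by rewrite [X in 2 ^+ X](nE) exprD invfM mulrAC mulVf ?mul1r.
Qed.

(** When fewer than half of the nodes are high, the other leaves number at least [(n - 1) / 2]; the
    [.+1] accounts for the hub, which is never high. *)
Definition low_union : set (n.-tuple R) :=
  \big[setU/set0]_(I : {set 'I_n} | (n <= (2 * #|I|).+1)%N) low_set k I.

(** There are at most [2 ^ n] sets [I], so each must cost at most a multiple of [2 ^- (2 * n)]. As
    [6 * #|I| >= 3 * n - 3], the value [2 ^- 6] for [k] beats both this count and the [2 ^+ n] of
    [radial_low_set]. *)
Lemma radial_low_union : (P low_union <= (8 * 2 ^- n)%:E)%E.
Proof.
apply: (le_trans (measure_bigsetU_le P _)).
  by move=> I _; exact: measurable_low_set.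
have bnd (I : {set 'I_n}) : (n <= (2 * #|I|).+1)%N ->
    (P (low_set k I) <= (8 * 2 ^- (2 * n))%:E)%E.
  move=> nI; apply: (le_trans (radial_low_set I n0 rP k0)); rewrite lee_fin.
  apply: (@le_trans _ _ ((2 ^- 6) ^+ #|I| * 2 ^+ n)).
    by rewrite ler_pM2r ?exprn_gt0// lerXn2r// ?nnegrE ?invr_ge0 ?exprn_ge0// ltW.
  rewrite exprVn -exprM mulrC ler_pdivrMr ?exprn_gt0// mulrAC ler_pdivlMr ?exprn_gt0//.
  rewrite -exprD (_ : 8 = 2 ^+ 3); last by ring.
  by rewrite -exprD ler_eXn2l ?ltr1n//; lia.
apply: (@le_trans _ _ (\sum_(I : {set 'I_n} | (n <= (2 * #|I|).+1)%N) (8 * 2 ^- (2 * n) : R)%:E)%E).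
  exact: lee_sum.
rewrite sumEFin lee_fin sumr_const -[leLHS]mulr_natr.
apply: (@le_trans _ _ (8 * 2 ^- (2 * n) * (2 ^ n)%:R)).
  rewrite ler_wpM2l ?mulr_ge0 ?invr_ge0 ?exprn_ge0// ler_nat.
  by rewrite (leq_trans (max_card _))// -cardsT -powersetT card_powerset cardsT card_ord.
by rewrite natrX -mulrA ler_wpM2l// mul2n -addnn exprD invfM mulfVK.
Qed.

Lemma radial_bad_set : exists r (B : set (n.-tuple R)),
  [/\ 0 < r, measurable B, (P B <= (16 * 2 ^- uphalf n)%:E)%E &
    forall t, ~ B t -> [/\ r <= sqnorm t, (n <= 2 * #|high o k t|)%N &
      exists i j, [/\ i \in high o k t, j \in high o k t & tnth t i * tnth t j < 0]]].
Proof.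
have [r r0 Pr] := radial_small_ball n0 rP.
exists r, (sqball r `|` low_union `|` aligned o k).
have mlow : measurable low_union.
  by apply: bigsetU_measurable => I _; exact: measurable_low_set.
have mball : measurable (sqball (n := n) r) by exact: measurable_sqball.
have mal := @measurable_aligned _ _ o k.
split => //; first by apply: measurableU => //; exact: measurableU.
- apply: (le_trans (measureU2 _ _ _)) => //; first exact: measurableU.
  apply: (le_trans (leeD2r _ (measureU2 _ _ _))) => //.
  apply: (le_trans (leeD (leeD Pr radial_low_union) radial_aligned)).
  (* The small ball, the low sets and the aligned set contribute [2 + 8 + 2 = 12], below [16]. *)
  rewrite -!EFinD lee_fin -!mulrDl.
  have : (2 ^- n : R) <= 2 ^- uphalf n.
    by rewrite lef_pV2 ?posrE ?exprn_gt0// ler_eXn2l ?ltr1n// uphalf_half; lia.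
  have : 0 < (2 ^- uphalf n : R) by rewrite invr_gt0 exprn_gt0.
  lra.
move=> t Bt; have rt : r <= sqnorm t.
  by rewrite leNgt; apply/negP => rt; apply: Bt; left; left.
have nh : (n <= 2 * #|high o k t|)%N.
  rewrite leqNgt; apply/negP => nh; apply: Bt; left; right.
  pose I := (~: high o k t :\ o)%SET.
  have oh : o \notin high o k t by rewrite inE eqxx.
  have cI : (#|I|.+1 + #|high o k t| = n)%N.
    have := cardsC (high o k t); rewrite card_ord (cardsD1 o (~: _)%SET) inE oh.
    by rewrite /I add1n addnC.
  rewrite /low_union (bigD1 I)/=; last first.
    by move: cI nh; move: (#|I|) (#|high o k t|) => u v; lia.
  left => i; rewrite !inE => /andP[io]; rewrite io /= -leNgt.
  by [].
split => //; apply: contrapT => noij; apply: Bt; right; split => // i j ih jh.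
by rewrite leNgt; apply/negP => ij; apply: noij; exists i, j.
Qed.

End bad_set_bound.

(** * The instance and its global minima *)

Section star_problem.
Context {R : realType} {n : nat}.
Variables (o : 'I_n).

Lemma star_symmetric : symmetric_edges (star_graph o).
Proof. by move=> i j; rewrite !inE /= eq_sym => /or3P[->|->|->]; rewrite ?orbT. Qed.

Lemma star_connected : connected_graph (star_graph o).
Proof.
move=> i j; apply: (@connect_trans _ _ o); apply: connect1; rewrite /= !inE /= eqxx ?orbT//.
Qed.

Lemma star_not_bipartite : ~ bipartite (star_graph o).
Proof. by move=> [side /(_ o o)]; rewrite inE /= eqxx => /(_ isT); rewrite eqxx. Qed.

Variables (c a : R).
Hypotheses (c0 : 0 < c) (a0 : 0 < a).

Let z := star_truth o c a.

Lemma star_truth_gt0 i : 0 < z i 0.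
Proof. by rewrite mxE; case: ifP => // _; rewrite mulr_gt0. Qed.

Lemma star_problem_class : problem_class (star_graph o) (z *m z^T).
Proof.
split; [|apply/eqP|move=> i j|exact: star_connected|exact: star_not_bipartite].
- split=> [|v]; first by rewrite trmx_mul trmxK.
  have -> : v^T *m (z *m z^T) *m v = (z^T *m v)^T *m (z^T *m v).
    by rewrite trmx_mul trmxK !mulmxA.
  by rewrite mxE big_ord1 mxE -expr2 sqr_ge0.
- rewrite eqn_leq mxrank_outer lt0n mxrank_eq0; apply/eqP => /matrixP/(_ o o).
  by rewrite outer_mxE [RHS]mxE; apply/eqP; rewrite mulf_neq0// gt_eqF// star_truth_gt0.
by rewrite outer_mxE mulf_neq0// gt_eqF// star_truth_gt0.
Qed.

(** As [z] attains the least value [g 0], uniqueness of the minimizer of [g] makes the masked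
    residual of any other minimizer vanish. The loop at the hub then fixes [x o] up to sign, and the
    edges of the hub fix the rest. *)
Lemma star_argmin (g : 'M[R]_n -> R) (x : 'cV[R]_n) :
  (forall N : 'M[R]_n, is_argmin (supported (star_graph o)) g N <-> N = 0) ->
  is_argmin setT (objective g (star_graph o) (z *m z^T)) x <-> x = z \/ x = - z.
Proof.
move=> gP; have [_ g0] := (gP 0).2 erefl.
have m0 : mask (star_graph o) (0 : 'M[R]_n) = 0.
  by apply/matrixP => i j; rewrite !mxE if_same.
have fz : objective g (star_graph o) (z *m z^T) z = g 0 by rewrite /objective subrr m0.
have fzN : objective g (star_graph o) (z *m z^T) (- z) = g 0.
  by rewrite /objective linearN /= mulNmx mulmxN opprK subrr m0.
split; last first.
  move=> xz; split=> // y _; have -> : objective g (star_graph o) (z *m z^T) x = g 0.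
    by case: xz => ->.
  by apply: g0; exact: mask_supported.
move=> [_ /(_ z I)]; rewrite fz => fx.
have : mask (star_graph o) (x *m x^T - z *m z^T) = 0.
  apply/gP; split; first exact: mask_supported.
  by move=> N sN; apply: (le_trans fx); exact: g0.
move=> /matrixP E; have Exz i j : (i, j) \in star_graph o -> x i 0 * x j 0 = z i 0 * z j 0.
  move=> ij; have := E i j; rewrite mxE ij [RHS]mxE mxE [X in _ + X]mxE !outer_mxE.
  by move/eqP; rewrite subr_eq0 => /eqP.
have Eo : x o 0 ^+ 2 = z o 0 ^+ 2 by rewrite !expr2; apply: Exz; rewrite inE/= eqxx.
have Ei i : x o 0 * x i 0 = z o 0 * z i 0 by apply: Exz; rewrite inE/= eqxx orbT.
have zo0 : z o 0 != 0 by rewrite gt_eqF// star_truth_gt0.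
move/eqP : Eo; rewrite eqf_sqr => /orP[]/eqP xo; [left|right];
  apply/matrixP => i j; rewrite (ord1 j); apply: (mulfI zo0); have := Ei i; rewrite xo//.
by rewrite mulNr !mxE => /eqP; rewrite eqr_oppLR => /eqP ->; rewrite mulrN.
Qed.

End star_problem.

(* The bound is on the outer probability of the success event: it implies the
   bound on its probability. *)
Theorem theorem4 (R : realType) :
  exists c C : R, [/\ 0 < c, 0 < C &
  forall n : nat, (3 <= n)%N ->
  exists E : {set 'I_n * 'I_n},
    [/\ symmetric_edges E, connected_graph E, ~ bipartite E &
    forall (g : 'M[R]_n -> R) (delta : R) (P : probability (n.-tuple R) R),
      class_C2 g ->
      (forall N : 'M[R]_n, is_argmin (supported E) g N <-> N = 0) ->
      0 <= delta -> delta < 1 -> delta <= c / n%:R ->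
      sparse_rip delta 1 E g ->
      ac_radial P ->
      exists Mstar : 'M[R]_n,
        [/\ problem_class E Mstar,
            (exists z : 'cV[R]_n, forall x : 'cV[R]_n,
               is_argmin setT (objective g E Mstar) x <-> x = z \/ x = - z)
          & (exists2 B : set (n.-tuple R),
               measurable B /\ success_set g E Mstar `<=` B
               & (P B <= (C * 2 ^- uphalf n)%:E)%E)]]].
Proof.
pose k : R := 2 ^- 6.
have k0 : 0 < k by rewrite invr_gt0 exprn_gt0.
have k4 : k <= 4^-1 by rewrite lef_pV2 ?posrE ?exprn_gt0//; lra.
have [K [c [v0 [Kk /andP[c0 cle1] v0p v0E [c1 c2]]]]] := constants_exist k0.
exists c, 16; split => // n n3.
have n0 : (0 < n)%N by exact: leq_trans n3.
pose o := Ordinal n0.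
exists (star_graph o); split; [exact: star_symmetric|exact: star_connected|exact: star_not_bipartite|].
move=> g delta P C2 gP d0 _ dn rip rP.
have g0 : is_argmin (supported (star_graph o)) g 0 by exact/gP.
(* The barriers need [n >= 8]. For [n <= 7] we have [uphalf n <= 4], and the constant [16] makes the
   bound at least 1. *)
have [n8|n8] := leqP 8 n; last first.
  exists (star_truth o c 1 *m (star_truth o c 1)^T); split.
  - exact: star_problem_class.
  - by exists (star_truth o c 1) => x; exact: star_argmin.
  exists setT; first by split => //.
  rewrite probability_setT lee_fin ler_pdivlMr ?exprn_gt0// mul1r.
  rewrite (_ : 16 = 2 ^+ 4); last by ring.
  have uh : (uphalf n <= 4)%N by move: n8; clear; lia.
  by rewrite ler_eXn2l ?ltr1n.
have nr : 0 < n%:R :> R by rewrite ltr0n.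
have [r [B [r0 mB PB Bt]]] := radial_bad_set o k0 (lexx _) rP.
(* The radius [r], and with it [a], depends on the distribution: outside [B] we have
   [r <= sqnorm t], so [a ^+ 2] is at most [k ^+ 2 * sqnorm t / n], as the initial floor
   requires. *)
pose a := Num.sqrt (k ^+ 2 * r / n%:R).
have a2 : 0 < k ^+ 2 * r / n%:R by rewrite divr_gt0// mulr_gt0// exprn_gt0.
have a0 : 0 < a by rewrite sqrtr_gt0.
exists (star_truth o c a *m (star_truth o c a)^T); split.
- exact: star_problem_class.
- by exists (star_truth o c a) => x; exact: star_argmin.
exists B => //; split => // t; apply: contraPP => /Bt[rt nh [i [j [ih jh ij]]]].
apply: (flow_not_success k0 k4 c0 cle1 v0p Kk v0E c1 c2 n8 a0 C2 d0 dn g0 rip _ nh _ _ ih jh ij).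
- by rewrite inE eqxx.
- by move=> l; rewrite inE => /andP[_]; rewrite /share_gap card_ord subr_gt0.
rewrite sqr_sqrtr ?(ltW a2)// ler_pM2r ?invr_gt0// ler_pM2l ?exprn_gt0//.
Qed.
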